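(* Let $\mu$ be any critical offspring distribution. Then, as $n\to\infty$ along integers $n$ with $\mathbf P(|\mathrm{T}|=n)>0$, \[ \mathsf{Height}(\mathrm{T}_n)=\omega_{\mathbf P}(\ln n)\qquad\text{and}\qquad \mathsf{Width}(\mathrm{T}_n)=o_{\mathbf P}(n). \] That is, $\mathsf{Height}(\mathrm{T}_n)/\ln n\to\infty$ in probability and $\mathsf{Width}(\mathrm{T}_n)/n\to 0$ in probability.
   Context: An offspring distribution is a probability measure $\mu=(\mu_k)_{k\ge 0}$ on $\mathbb Z_+=\{0,1,2,\dots\}$; it is critical if $\sum_{k\ge0}k\mu_k=1$. A $\mu$-Bienaymé tree $\mathrm{T}=\mathrm{T}(\mu)$ is the family tree of a Galton–Watson branching process with offspring distribution $\mu$ started from one individual (a random rooted plane tree with $\mathbf P(\mathrm{T}=\mathrm t)=\prod_{u\in\mathrm t}\mu_{k_u(\mathrm t)}$ for each finite plane tree $\mathrm t$, where $k_u(\mathrm t)$ is the number of children of $u$). For $n$ with $\mathbf P(|\mathrm T|=n)>0$, $\mathrm T_n$ denotes $\mathrm T$ conditioned to have exactly $n$ vertices. The height $\mathsf{Height}(\mathrm t)$ of a rooted tree is the largest distance of a vertex from the root; the width $\mathsf{Width}(\mathrm t)$ is the largest number of vertices in a single generation (at a single distance from the root). *)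

(* Defs.v *)
From Stdlib Require Import Reals List Arith.
Import ListNotations.
Open Scope R_scope.

Inductive tree : Type := Node : list tree -> tree.

Fixpoint tsize (t : tree) : nat :=
  match t with Node f => S (list_sum (map tsize f)) end.

Fixpoint height (t : tree) : nat :=
  match t with
  | Node f => fold_right (fun c m => Nat.max (S (height c)) m) 0%nat f
  end.

Fixpoint gen (k : nat) (t : tree) : nat :=
  match k, t with
  | O, _ => 1%nat
  | S k', Node f => list_sum (map (gen k') f)
  end.

(** Width: largest size of a generation (generations k >= |t| are empty). *)
Definition width (t : tree) : nat :=
  fold_right Nat.max 0%nat (map (fun k => gen k t) (seq 0 (tsize t))).

(** Bienaymé weight P(T = t) = prod_{u in t} mu_{k_u(t)}. *)
Fixpoint weight (mu : nat -> R) (t : tree) : R :=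
  match t with
  | Node f => mu (length f) * fold_right (fun c r => weight mu c * r) 1 f
  end.

(** Enumeration of all plane forests (ordered lists of trees) with n vertices
    in total; fuel >= n suffices. *)
Fixpoint forests_fuel (fuel n : nat) : list (list tree) :=
  match fuel with
  | O => match n with O => [ [] ] | S _ => [] end
  | S fuel' =>
      match n with
      | O => [ [] ]
      | S _ =>
        flat_map (fun k =>
          flat_map (fun f =>
            map (fun g => Node f :: g) (forests_fuel fuel' (n - S k)))
            (forests_fuel fuel' k))
          (seq 0 n)
      end
  end.

Definition forests_of_size (n : nat) : list (list tree) := forests_fuel n n.

(** All plane trees with exactly n vertices (each listed once). *)
Definition trees_of_size (n : nat) : list tree :=
  match n with
  | O => []
  | S m => map Node (forests_of_size m)
  end.

Definition prob_size (mu : nat -> R) (n : nat) : R :=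
  fold_right Rplus 0 (map (weight mu) (trees_of_size n)).

Definition Pcond (mu : nat -> R) (n : nat) (A : tree -> bool) : R :=
  fold_right Rplus 0
    (map (fun t => if A t then weight mu t else 0) (trees_of_size n))
  / prob_size mu n.

Definition critical_offspring (mu : nat -> R) : Prop :=
  (forall k, 0 <= mu k) /\
  infinite_sum mu 1 /\
  infinite_sum (fun k => INR k * mu k) 1.

(* Main.v *)
(** Write a_n = P(|T| = n) and let A(z) = sum a_n z^n, so that A = z G(A) with G the
    generating function of mu.

    Criticality gives G(y) >= y, so A(z) = oo for all z > 1; since grafting trees at
    leaves makes (a_n) essentially supermultiplicative, a_n = exp(-o(n)) along
    admissible n.  Hence every event of probability exp(-cn) is negligible under the
    conditioning.

    Width: if generation k has more than delta n vertices, a forest of that many trees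
    has at most n vertices, i.e. a centred walk with steps >= -1 goes down by delta n
    within n steps, which has probability exp(-cn).

    Height: up to an event of probability exp(-cn), the empirical degree law nu of T_n
    has truncated mean at least 1 - eps.  Given its degrees, T_n is uniform, hence is
    a nu-Bienaymé tree conditioned on its degrees.  There are O(sqrt n) distinct
    degrees, so this conditioning costs only exp(O(sqrt n ln n)), whereas a
    nu-Bienaymé tree has size n and height at most M ln n with probability at most
    exp(-n^(3/4)), up to constants, because one generation multiplies the survival
    probability by at least 1 - 3 eps. *)

Require Import Defs.
From Stdlib Require Import Reals List Arith ZArith Lia Lra Permutation.
From Stdlib Require Import ClassicalEpsilon.
Import ListNotations.
Open Scope R_scope.

(** The lower bound on a_n comes without a rate: it absorbs events of probability exp(-cn), but not
    the stretched exponential bound available for short trees. So the height argument cannot compare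
    with P(|T| = n) directly. It compares inside a class of trees with the same degrees, whose
    probability under its own empirical law has an explicit lower bound.

    All tail bounds share one device. Each vertex receives a modified weight, chosen so that the
    total mass of all trees stays at most 1 while on the event the modified weight exceeds the
    original one by the desired factor. The mass is controlled by a supersolution of the branching
    recursion: a number y with G(y) <= y, or a sequence with G(y_k) <= y_(k+1), where G belongs to
    the modified weights. Everything is finite: sums run over trees with at most N vertices, and the
    bounds are uniform in N.

    Any exponent strictly between 1/2, the cost of fixing the degrees, and 1 would serve in place of
    3/4. *)

(** * Finite sums and products over lists *)

Definition lsum {A : Type} (f : A -> R) (l : list A) : R :=
  fold_right Rplus 0 (map f l).

(** Like [lsum], this copies the shape of a fold in the definitions ([weight] here, [prob_size] and
    [Pcond] for [lsum]), so passing between the two is mere conversion. *)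
Definition lprod {A : Type} (f : A -> R) (l : list A) : R :=
  fold_right (fun c r => f c * r) 1 l.

Lemma lsum_cons {A} (f : A -> R) a l : lsum f (a :: l) = f a + lsum f l.
Proof. reflexivity. Qed.

Lemma lprod_cons {A} (f : A -> R) a l : lprod f (a :: l) = f a * lprod f l.
Proof. reflexivity. Qed.

Lemma lsum_app {A} (f : A -> R) l l' : lsum f (l ++ l') = lsum f l + lsum f l'.
Proof.
  induction l as [|a l IH]; cbn [app]; [unfold lsum; simpl; lra|].
  rewrite !lsum_cons, IH; lra.
Qed.

Lemma lprod_app {A} (f : A -> R) l l' : lprod f (l ++ l') = lprod f l * lprod f l'.
Proof.
  induction l as [|a l IH]; cbn [app]; [unfold lprod; simpl; lra|].
  rewrite !lprod_cons, IH; lra.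
Qed.

Lemma lsum_le_in {A} (f g : A -> R) l :
  (forall a, In a l -> f a <= g a) -> lsum f l <= lsum g l.
Proof.
  induction l as [|a l IH]; intros H; [apply Rle_refl|].
  rewrite !lsum_cons. apply Rplus_le_compat; [apply H; now left|].
  apply IH; intros; apply H; now right.
Qed.

Lemma lsum_ext_in {A} (f g : A -> R) l :
  (forall a, In a l -> f a = g a) -> lsum f l = lsum g l.
Proof.
  intros H; apply Rle_antisym; apply lsum_le_in; intros a Ha; rewrite (H a Ha); lra.
Qed.

Lemma lsum_nonneg {A} (f : A -> R) l :
  (forall a, In a l -> 0 <= f a) -> 0 <= lsum f l.
Proof.
  induction l as [|a l IH]; intros H; [apply Rle_refl|].
  rewrite lsum_cons. pose proof (H a (or_introl eq_refl)).
  assert (0 <= lsum f l) by (apply IH; intros; apply H; now right). lra.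
Qed.

Lemma lsum_scal {A} (c : R) (f : A -> R) l : lsum (fun a => c * f a) l = c * lsum f l.
Proof.
  induction l as [|a l IH]; [unfold lsum; simpl; lra|]. rewrite !lsum_cons, IH; lra.
Qed.

Lemma lsum_scal_r {A} (c : R) (f : A -> R) l : lsum (fun a => f a * c) l = lsum f l * c.
Proof.
  induction l as [|a l IH]; [unfold lsum; simpl; lra|]. rewrite !lsum_cons, IH; lra.
Qed.

Lemma lsum_plus {A} (f g : A -> R) l : lsum (fun a => f a + g a) l = lsum f l + lsum g l.
Proof.
  induction l as [|a l IH]; [unfold lsum; simpl; lra|]. rewrite !lsum_cons, IH; lra.
Qed.

Lemma lsum_const {A} (c : R) (l : list A) : lsum (fun _ => c) l = INR (length l) * c.
Proof.
  induction l as [|a l IH]; [unfold lsum; simpl; lra|].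
  rewrite lsum_cons, IH. cbn [length]. rewrite S_INR; lra.
Qed.

Lemma lsum_map {A B} (f : B -> R) (h : A -> B) l : lsum f (map h l) = lsum (fun a => f (h a)) l.
Proof. unfold lsum; now rewrite map_map. Qed.

Lemma lsum_flat_map {A B} (f : B -> R) (h : A -> list B) l :
  lsum f (flat_map h l) = lsum (fun a => lsum f (h a)) l.
Proof.
  induction l as [|a l IH]; [reflexivity|].
  cbn [flat_map]. now rewrite lsum_app, lsum_cons, IH.
Qed.

Lemma lsum_exchange {A B} (f : A -> B -> R) l l' :
  lsum (fun a => lsum (f a) l') l = lsum (fun b => lsum (fun a => f a b) l) l'.
Proof.
  induction l as [|a l IH].
  - unfold lsum at 1; simpl. symmetry.
    rewrite (lsum_ext_in _ (fun _ => 0)) by reflexivity. rewrite lsum_const; lra.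
  - rewrite lsum_cons, IH, <- lsum_plus. apply lsum_ext_in; intros b _. reflexivity.
Qed.

Lemma lsum_incl {A} (f : A -> R) l l' :
  NoDup l -> incl l l' -> (forall a, In a l' -> 0 <= f a) -> lsum f l <= lsum f l'.
Proof.
  revert l'. induction l as [|a l IH]; intros l' Hnd Hi Hp.
  - apply lsum_nonneg, Hp.
  - inversion Hnd as [|? ? Ha Hl]; subst.
    destruct (in_split a l' (Hi a (or_introl eq_refl))) as (l1 & l2 & ->).
    rewrite lsum_cons, lsum_app, lsum_cons.
    assert (lsum f l <= lsum f (l1 ++ l2)) as H.
    { apply IH; auto.
      - intros b Hb. pose proof (Hi b (or_intror Hb)) as Hin.
        apply in_app_or in Hin. apply in_or_app.
        destruct Hin as [|[->|]]; auto. contradiction.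
      - intros b Hb; apply Hp. apply in_app_or in Hb. apply in_or_app.
        destruct Hb; [left|right; right]; assumption. }
    rewrite lsum_app in H. lra.
Qed.

Lemma lsum_ge_term {A} (f : A -> R) l a :
  In a l -> (forall b, In b l -> 0 <= f b) -> f a <= lsum f l.
Proof.
  intros Ha Hp. replace (f a) with (lsum f [a]) by (unfold lsum; simpl; lra).
  apply lsum_incl; auto.
  - repeat constructor; simpl; tauto.
  - intros b [->|[]]; auto.
Qed.

Lemma lprod_nonneg {A} (f : A -> R) l :
  (forall a, In a l -> 0 <= f a) -> 0 <= lprod f l.
Proof.
  induction l as [|a l IH]; intros H; [unfold lprod; simpl; lra|].
  rewrite lprod_cons. apply Rmult_le_pos; [apply H; now left|].
  apply IH; intros; apply H; now right.
Qed.

Lemma lprod_pos {A} (f : A -> R) l :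
  (forall a, In a l -> 0 < f a) -> 0 < lprod f l.
Proof.
  induction l as [|a l IH]; intros H; [unfold lprod; simpl; lra|].
  rewrite lprod_cons. apply Rmult_lt_0_compat; [apply H; now left|].
  apply IH; intros; apply H; now right.
Qed.

Lemma lprod_le_in {A} (f g : A -> R) l :
  (forall a, In a l -> 0 <= f a <= g a) -> lprod f l <= lprod g l.
Proof.
  induction l as [|a l IH]; intros H; [apply Rle_refl|].
  rewrite !lprod_cons. apply Rmult_le_compat.
  - apply H; now left.
  - apply lprod_nonneg; intros b Hb; apply H; now right.
  - apply H; now left.
  - apply IH; intros; apply H; now right.
Qed.

Lemma lprod_ext_in {A} (f g : A -> R) l :
  (forall a, In a l -> f a = g a) -> lprod f l = lprod g l.
Proof.
  induction l as [|a l IH]; intros H; [reflexivity|].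
  rewrite !lprod_cons, (H a (or_introl eq_refl)), IH; auto.
  intros; apply H; now right.
Qed.

Lemma lprod_mult {A} (f g : A -> R) l :
  lprod (fun a => f a * g a) l = lprod f l * lprod g l.
Proof.
  induction l as [|a l IH]; [unfold lprod; simpl; lra|]. rewrite !lprod_cons, IH; lra.
Qed.

Lemma lprod_const {A} (c : R) (l : list A) : lprod (fun _ => c) l = c ^ length l.
Proof.
  induction l as [|a l IH]; [reflexivity|]. now rewrite lprod_cons, IH.
Qed.

Lemma lprod_exp {A} (f : A -> R) l : lprod (fun a => exp (f a)) l = exp (lsum f l).
Proof.
  induction l as [|a l IH]; [unfold lprod, lsum; simpl; now rewrite exp_0|].
  now rewrite lprod_cons, lsum_cons, IH, exp_plus.
Qed.

Lemma lprod_flat_map {A B} (f : B -> R) (h : A -> list B) l :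
  lprod f (flat_map h l) = lprod (fun a => lprod f (h a)) l.
Proof.
  induction l as [|a l IH]; [reflexivity|].
  cbn [flat_map]. now rewrite lprod_app, lprod_cons, IH.
Qed.

Lemma lprod_perm {A} (f : A -> R) l l' : Permutation l l' -> lprod f l = lprod f l'.
Proof.
  induction 1; rewrite ?lprod_cons in *; auto; try congruence. ring.
Qed.

Lemma NoDup_flat_map_intro {A B} (h : A -> list B) l :
  NoDup l -> (forall a, In a l -> NoDup (h a)) ->
  (forall a b x, In a l -> In b l -> In x (h a) -> In x (h b) -> a = b) ->
  NoDup (flat_map h l).
Proof.
  induction l as [|a l IH]; intros Hl Hn Hd; [constructor|].
  inversion Hl; subst. cbn [flat_map]. apply NoDup_app.
  - apply Hn; now left.
  - apply IH; auto.
    + intros; apply Hn; now right.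
    + intros b c x Hb Hc; apply Hd; now right.
  - intros x Hx Hin. apply in_flat_map in Hin as (b & Hb & Hxb).
    assert (a = b) by (apply (Hd a b x); simpl; auto). now subst.
Qed.

Lemma NoDup_map_intro {A B} (h : A -> B) l :
  NoDup l -> (forall a b, In a l -> In b l -> h a = h b -> a = b) -> NoDup (map h l).
Proof.
  induction l as [|a l IH]; intros Hl Hinj; [constructor|].
  inversion Hl; subst. cbn [map]. constructor.
  - intros Hin. apply in_map_iff in Hin as (b & Hb & Hbl).
    assert (b = a) by (apply Hinj; simpl; auto). now subst.
  - apply IH; auto. intros b c Hb Hc; apply Hinj; now right.
Qed.

(** * Trees and their enumeration *)

(** The principle generated for the nested type [tree] gives no hypothesis on the children. The
    inner induction on the list keeps the recursive calls guarded. *)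
Lemma tree_forest_ind (P : tree -> Prop) :
  (forall f, (forall c, In c f -> P c) -> P (Node f)) -> forall t, P t.
Proof.
  intros H. fix IH 1. intros [f]. apply H.
  induction f as [|c f IHf]; [intros _ []|].
  intros d [<-|Hd]; [apply IH|now apply IHf].
Qed.

Definition fsize (f : list tree) : nat := list_sum (map tsize f).

Lemma fsize_cons c f : fsize (c :: f) = (tsize c + fsize f)%nat.
Proof. reflexivity. Qed.

Lemma tsize_Node f : tsize (Node f) = S (fsize f).
Proof. reflexivity. Qed.

Lemma tsize_pos t : (1 <= tsize t)%nat.
Proof. destruct t; rewrite tsize_Node; lia. Qed.

Lemma length_le_fsize f : (length f <= fsize f)%nat.
Proof.
  induction f as [|c f IH]; [apply le_n|].
  rewrite fsize_cons. cbn [length]. pose proof (tsize_pos c). lia.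
Qed.

Lemma tsize_le_fsize c f : In c f -> (tsize c <= fsize f)%nat.
Proof.
  induction f as [|d f IH]; intros []; rewrite fsize_cons.
  - subst; lia.
  - specialize (IH H); lia.
Qed.

Lemma in_forests_fuel fuel n f : (n <= fuel)%nat ->
  In f (forests_fuel fuel n) <-> fsize f = n.
Proof.
  revert n f. induction fuel as [|fuel IH]; intros n f Hn.
  - assert (n = 0%nat) by lia; subst. simpl. split.
    + intros [<-|[]]; reflexivity.
    + intros H. destruct f as [|c f]; [now left|].
      rewrite fsize_cons in H. pose proof (tsize_pos c); lia.
  - destruct n as [|n].
    { simpl. split.
      + intros [<-|[]]; reflexivity.
      + intros H. destruct f as [|c f]; [now left|].
        rewrite fsize_cons in H. pose proof (tsize_pos c); lia. }
    cbn [forests_fuel]. rewrite in_flat_map. split.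
    + intros (k & Hk & Hin). apply in_seq in Hk.
      apply in_flat_map in Hin as (g & Hg & Hin).
      apply in_map_iff in Hin as (g' & <- & Hg').
      apply IH in Hg; [|lia]. apply IH in Hg'; [|lia].
      rewrite fsize_cons, tsize_Node. lia.
    + intros H. destruct f as [|[g] g']; [discriminate|].
      rewrite fsize_cons, tsize_Node in H.
      exists (fsize g). split; [apply in_seq; lia|].
      apply in_flat_map. exists g. split; [apply IH; lia|].
      apply in_map_iff. exists g'. split; [reflexivity|]. apply IH; lia.
Qed.

Lemma NoDup_forests_fuel fuel n : (n <= fuel)%nat -> NoDup (forests_fuel fuel n).
Proof.
  revert n. induction fuel as [|fuel IH]; intros [|n] Hn;
    try (repeat constructor; simpl; tauto).
  cbn [forests_fuel]. apply NoDup_flat_map_intro.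
  - apply seq_NoDup.
  - intros k Hk. apply in_seq in Hk. apply NoDup_flat_map_intro.
    + apply IH; lia.
    + intros g _. apply NoDup_map_intro; [apply IH; lia|]. congruence.
    + intros g g' x _ _ H H'. apply in_map_iff in H as (? & <- & _).
      apply in_map_iff in H' as (? & E & _). congruence.
  - intros k k' x Hk Hk' H H'. apply in_seq in Hk, Hk'.
    apply in_flat_map in H as (g & Hg & H). apply in_flat_map in H' as (g' & Hg' & H').
    apply in_map_iff in H as (? & <- & _). apply in_map_iff in H' as (? & E & _).
    apply in_forests_fuel in Hg; [|lia]. apply in_forests_fuel in Hg'; [|lia].
    congruence.
Qed.

Lemma in_trees_of_size n t : In t (trees_of_size n) <-> tsize t = n.
Proof.
  destruct n as [|n].
  - simpl. pose proof (tsize_pos t). split; [tauto|lia].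
  - unfold trees_of_size, forests_of_size. rewrite in_map_iff. split.
    + intros (f & <- & Hf). apply in_forests_fuel in Hf; [|lia].
      rewrite tsize_Node; lia.
    + destruct t as [f]. rewrite tsize_Node. intros H. exists f. split; [reflexivity|].
      apply in_forests_fuel; lia.
Qed.

Lemma NoDup_trees_of_size n : NoDup (trees_of_size n).
Proof.
  destruct n as [|n]; [constructor|]. apply NoDup_map_intro; [|congruence].
  now apply NoDup_forests_fuel.
Qed.

(** A finite stand-in for the set of all finite trees. Bounding the size rather than fixing it makes
    the list closed under passing to subtrees. *)
Definition trees_upto (N : nat) : list tree := flat_map trees_of_size (seq 0 (S N)).

Lemma in_trees_upto N t : In t (trees_upto N) <-> (tsize t <= N)%nat.
Proof.
  unfold trees_upto. rewrite in_flat_map. split.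
  - intros (k & Hk & Ht). apply in_seq in Hk. apply in_trees_of_size in Ht. lia.
  - intros H. exists (tsize t). split; [apply in_seq; lia|]. now apply in_trees_of_size.
Qed.

Lemma NoDup_trees_upto N : NoDup (trees_upto N).
Proof.
  apply NoDup_flat_map_intro.
  - apply seq_NoDup.
  - intros; apply NoDup_trees_of_size.
  - intros a b x _ _ Ha Hb. apply in_trees_of_size in Ha, Hb. congruence.
Qed.

Lemma lsum_trees_of_size_le (g : tree -> R) n :
  (forall t, 0 <= g t) -> lsum g (trees_of_size n) <= lsum g (trees_upto n).
Proof.
  intros Hg. apply lsum_incl; auto using NoDup_trees_of_size.
  intros t Ht. apply in_trees_of_size in Ht. apply in_trees_upto. lia.
Qed.

Fixpoint tuples {A : Type} (k : nat) (L : list A) : list (list A) :=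
  match k with
  | O => [[]]
  | S k' => flat_map (fun c => map (cons c) (tuples k' L)) L
  end.

Lemma in_tuples {A} k (L : list A) f : In f (tuples k L) <-> length f = k /\ incl f L.
Proof.
  revert f. induction k as [|k IH]; intros f; cbn [tuples].
  - split.
    + intros [<-|[]]. split; [reflexivity|]. intros ? [].
    + intros [H _]. destruct f; [now left|discriminate].
  - rewrite in_flat_map. split.
    + intros (c & Hc & H). apply in_map_iff in H as (g & <- & Hg).
      apply IH in Hg as [Hl Hi]. split; [simpl; congruence|].
      now apply incl_cons.
    + intros [Hl Hi]. destruct f as [|c f]; [discriminate|].
      apply incl_cons_inv in Hi as [Hc Hi]. exists c. split; [assumption|].
      apply in_map. apply IH. split; [simpl in Hl; congruence|assumption].
Qed.

Lemma NoDup_tuples {A} k (L : list A) : NoDup L -> NoDup (tuples k L).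
Proof.
  intros HL. induction k as [|k IH]; cbn [tuples].
  - repeat constructor; simpl; tauto.
  - apply NoDup_flat_map_intro; auto.
    + intros c _. apply NoDup_map_intro; [assumption|congruence].
    + intros c d x _ _ Hc Hd. apply in_map_iff in Hc as (? & <- & _).
      apply in_map_iff in Hd as (? & E & _). congruence.
Qed.

Lemma lsum_tuples {A} (g : A -> R) k L : lsum (lprod g) (tuples k L) = lsum g L ^ k.
Proof.
  induction k as [|k IH]; cbn [tuples].
  - unfold lsum, lprod; simpl; lra.
  - rewrite lsum_flat_map. cbn [pow].
    rewrite (lsum_ext_in _ (fun c => g c * lsum g L ^ k)).
    + now rewrite lsum_scal_r.
    + intros c _. rewrite lsum_map, <- IH, <- lsum_scal. reflexivity.
Qed.

(** * The branching recursion for sums over trees *)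

(** Two instances matter: [g' = g], where [g] is a tree weight, and [g], [g'] two consecutive
    iterates of a recursion that stops at a fixed depth. *)
Section Branching.

Variables (v : nat -> R) (g g' : tree -> R).
Hypothesis (v_ge0 : forall k, 0 <= v k) (g'_ge0 : forall t, 0 <= g' t).
Hypothesis (g_Node : forall f, g (Node f) = v (length f) * lprod g' f).

Let nodes (B : nat) (L : list tree) :=
  map Node (flat_map (fun k => tuples k L) (seq 0 B)).

Lemma in_nodes B L f : In (Node f) (nodes B L) <-> (length f < B)%nat /\ incl f L.
Proof.
  unfold nodes. rewrite in_map_iff. split.
  - intros (f' & E & H). injection E as ->. apply in_flat_map in H as (k & Hk & H).
    apply in_seq in Hk. apply in_tuples in H. split; [lia|tauto].
  - intros [H Hi]. exists f. split; [reflexivity|]. apply in_flat_map.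
    exists (length f). split; [apply in_seq; lia|]. now apply in_tuples.
Qed.

Lemma NoDup_nodes B L : NoDup L -> NoDup (nodes B L).
Proof.
  intros HL. apply NoDup_map_intro; [|congruence].
  apply NoDup_flat_map_intro; auto using seq_NoDup, NoDup_tuples.
  intros a b x _ _ Ha Hb. apply in_tuples in Ha, Hb. destruct Ha, Hb; congruence.
Qed.

Lemma lsum_nodes B L :
  lsum g (nodes B L) = lsum (fun k => v k * lsum g' L ^ k) (seq 0 B).
Proof.
  unfold nodes. rewrite lsum_map, lsum_flat_map. apply lsum_ext_in. intros k _.
  rewrite <- lsum_tuples, <- lsum_scal. apply lsum_ext_in. intros f Hf.
  apply in_tuples in Hf as [<- _]. apply g_Node.
Qed.

Lemma g_ge0 t : 0 <= g t.
Proof.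
  destruct t as [f]. rewrite g_Node. apply Rmult_le_pos; auto. apply lprod_nonneg; auto.
Qed.

(** A tree with at most N + 1 vertices has at most N children, each with at most N vertices. *)
Lemma branching_sum_le N :
  lsum g (trees_upto (S N)) <=
  lsum (fun k => v k * lsum g' (trees_upto N) ^ k) (seq 0 (S N)).
Proof.
  rewrite <- lsum_nodes. apply lsum_incl; auto using NoDup_trees_upto, g_ge0.
  intros [f] Hf. apply in_trees_upto in Hf. rewrite tsize_Node in Hf.
  apply in_nodes. split.
  - pose proof (length_le_fsize f). lia.
  - intros c Hc. apply in_trees_upto. apply tsize_le_fsize in Hc. lia.
Qed.

(** Fewer than B children with at most N vertices each give at most 1 + B N vertices. Together with
    the previous bound this replaces the equation A = z G(A). *)
Lemma branching_sum_ge N B :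
  lsum (fun k => v k * lsum g' (trees_upto N) ^ k) (seq 0 B) <=
  lsum g (trees_upto (S (B * N))).
Proof.
  rewrite <- lsum_nodes. apply lsum_incl; auto using g_ge0, NoDup_nodes, NoDup_trees_upto.
  intros [f] Hf. apply in_nodes in Hf as [Hl Hi]. apply in_trees_upto.
  rewrite tsize_Node. apply le_n_S.
  transitivity (length f * N)%nat; [|apply Nat.mul_le_mono_r; lia].
  clear Hl. induction f as [|c f IH]; [apply le_n|].
  apply incl_cons_inv in Hi as [Hc Hi]. apply in_trees_upto in Hc.
  rewrite fsize_cons. specialize (IH Hi). cbn [length Nat.mul]. lia.
Qed.

End Branching.

Lemma weight_Node mu f : weight mu (Node f) = mu (length f) * lprod (weight mu) f.
Proof. reflexivity. Qed.

Lemma weight_ge0 mu t : (forall k, 0 <= mu k) -> 0 <= weight mu t.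
Proof.
  intros Hmu. induction t as [f IH] using tree_forest_ind. rewrite weight_Node.
  apply Rmult_le_pos; auto. apply lprod_nonneg, IH.
Qed.

Fixpoint degs (t : tree) : list nat :=
  match t with Node f => length f :: flat_map degs f end.

Definition fdegs (f : list tree) : list nat := flat_map degs f.

Lemma degs_Node f : degs (Node f) = length f :: fdegs f.
Proof. reflexivity. Qed.

(** The weight sees only the multiset of degrees; this is what makes a conditioned tree uniform
    given its degrees. *)
Lemma weight_degs mu t : weight mu t = lprod mu (degs t).
Proof.
  induction t as [f IH] using tree_forest_ind.
  rewrite weight_Node, degs_Node, lprod_cons. f_equal.
  unfold fdegs. rewrite lprod_flat_map. now apply lprod_ext_in.
Qed.

Lemma length_fdegs_of f :
  (forall c, In c f -> length (degs c) = tsize c) -> length (fdegs f) = fsize f.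
Proof.
  unfold fdegs. induction f as [|c f IH]; intros H; [reflexivity|].
  cbn [flat_map]. rewrite length_app, fsize_cons, IH, H; simpl; auto.
  intros; apply H; now right.
Qed.

Lemma length_degs t : length (degs t) = tsize t.
Proof.
  induction t as [f IH] using tree_forest_ind.
  rewrite degs_Node, tsize_Node. cbn [length]. f_equal. now apply length_fdegs_of.
Qed.

Lemma length_fdegs f : length (fdegs f) = fsize f.
Proof. apply length_fdegs_of. intros; apply length_degs. Qed.

Lemma sum_fdegs_of f :
  (forall c, In c f -> S (list_sum (degs c)) = tsize c) ->
  (length f + list_sum (fdegs f))%nat = fsize f.
Proof.
  unfold fdegs. induction f as [|c f IH]; intros H; [reflexivity|].
  cbn [flat_map length]. rewrite list_sum_app, fsize_cons, <- IH, <- H; simpl; auto; try lia.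
  intros; apply H; now right.
Qed.

(** Every vertex but the root is the child of exactly one vertex. *)
Lemma sum_degs t : S (list_sum (degs t)) = tsize t.
Proof.
  induction t as [f IH] using tree_forest_ind.
  rewrite degs_Node, tsize_Node. cbn [list_sum fold_right]. f_equal.
  now apply sum_fdegs_of.
Qed.

Lemma sum_fdegs f : (length f + list_sum (fdegs f))%nat = fsize f.
Proof. apply sum_fdegs_of. intros; apply sum_degs. Qed.

Lemma lsum_seq_mono (f : nat -> R) B B' :
  (forall k, 0 <= f k) -> (B <= B')%nat -> lsum f (seq 0 B) <= lsum f (seq 0 B').
Proof.
  intros Hf HB. apply lsum_incl; auto using seq_NoDup.
  intros k Hk. apply in_seq in Hk. apply in_seq. lia.
Qed.

Lemma lsum_seq_S (f : nat -> R) n : lsum f (seq 0 (S n)) = lsum f (seq 0 n) + f n.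
Proof. rewrite seq_S, lsum_app. unfold lsum at 2; simpl. lra. Qed.

Lemma lsum_seq_sum_f_R0 f n : lsum f (seq 0 (S n)) = sum_f_R0 f n.
Proof.
  induction n as [|n IH]; [unfold lsum; simpl; lra|].
  rewrite lsum_seq_S, IH. reflexivity.
Qed.

Lemma infinite_sum_partial_ge f l eps :
  (forall k, 0 <= f k) -> infinite_sum f l -> 0 < eps ->
  exists K, forall B, (K <= B)%nat -> l - eps < lsum f (seq 0 B).
Proof.
  intros Hf Hs He. destruct (Hs eps He) as [N HN]. exists (S N). intros B HB.
  specialize (HN N (le_n N)). apply Rabs_def2 in HN.
  rewrite <- lsum_seq_sum_f_R0 in HN.
  pose proof (lsum_seq_mono f _ _ Hf HB). lra.
Qed.

Lemma infinite_sum_partial_le f l B :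
  (forall k, 0 <= f k) -> infinite_sum f l -> lsum f (seq 0 B) <= l.
Proof.
  intros Hf Hs. apply Rnot_lt_le. intros Hlt.
  destruct (Hs (lsum f (seq 0 B) - l)) as [N HN]; [lra|].
  specialize (HN (N + B)%nat ltac:(lia)). apply Rabs_def2 in HN.
  rewrite <- lsum_seq_sum_f_R0 in HN.
  pose proof (lsum_seq_mono f B (S (N + B)) Hf ltac:(lia)). lra.
Qed.

Lemma exp_pow x k : exp x ^ k = exp (INR k * x).
Proof.
  induction k as [|k IH]; [simpl; now rewrite Rmult_0_l, exp_0|].
  cbn [pow]. rewrite IH, <- exp_plus, S_INR. f_equal; ring.
Qed.

Lemma exp_le_compat x y : x <= y -> exp x <= exp y.
Proof. intros [H| ->]; [left; now apply exp_increasing|apply Rle_refl]. Qed.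

(** * Subexponential lower bound on the size distribution *)

(** The leftmost leaf of [t] is replaced by [s]. One leaf disappears, which costs one vertex and one
    factor [mu 0]. *)
Fixpoint graft (t s : tree) : tree :=
  match t with
  | Node [] => s
  | Node (c :: f) => Node (graft c s :: f)
  end.

Lemma leftmost_ind (P : tree -> Prop) :
  P (Node []) -> (forall c f, P c -> P (Node (c :: f))) -> forall t, P t.
Proof.
  intros H0 H1 t. induction t as [f IH] using tree_forest_ind.
  destruct f as [|c f]; [assumption|]. apply H1, IH. now left.
Qed.

Lemma tsize_graft t s : S (tsize (graft t s)) = (tsize t + tsize s)%nat.
Proof.
  induction t as [|c f IH] using leftmost_ind; [reflexivity|].
  cbn [graft]. rewrite !tsize_Node, !fsize_cons. lia.
Qed.

Lemma weight_graft mu t s : mu 0%nat * weight mu (graft t s) = weight mu t * weight mu s.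
Proof.
  induction t as [|c f IH] using leftmost_ind.
  - cbn [graft]. rewrite weight_Node. unfold lprod; simpl. ring.
  - cbn [graft]. rewrite !weight_Node, !lprod_cons. cbn [length].
    transitivity (mu (S (length f)) * lprod (weight mu) f * (mu 0%nat * weight mu (graft c s)));
      [ring|rewrite IH; ring].
Qed.

(** Sizes strictly decrease down the leftmost branch, so the grafted subtree is the only one on it
    with the prescribed size, and it can be cut off again. *)
Lemma graft_inj t s t' s' :
  tsize s = tsize s' -> graft t s = graft t' s' -> t = t' /\ s = s'.
Proof.
  intros Hs. revert t'. induction t as [|c f IH] using leftmost_ind; intros t' E.
  - destruct t' as [[|c' f']]; [auto|exfalso].
    apply (f_equal tsize) in E. cbn [graft] in E. rewrite tsize_Node, fsize_cons in E.
    pose proof (tsize_graft c' s'). pose proof (tsize_pos c'). lia.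
  - destruct t' as [[|c' f']].
    + exfalso. apply (f_equal tsize) in E. cbn [graft] in E.
      rewrite tsize_Node, fsize_cons in E.
      pose proof (tsize_graft c s). pose proof (tsize_pos c). lia.
    + cbn [graft] in E. injection E as E <-. apply IH in E as [<- <-]. auto.
Qed.

Lemma prob_size_lsum mu n : prob_size mu n = lsum (weight mu) (trees_of_size n).
Proof. reflexivity. Qed.

Lemma prob_size_1 mu : prob_size mu 1 = mu 0%nat.
Proof. unfold prob_size; simpl. ring. Qed.

(** Grafting injects pairs of trees into trees. The shift of sizes by one makes n -> a_(n+1) / mu_0
    truly supermultiplicative. *)
Lemma prob_size_supermult mu n m : (forall k, 0 <= mu k) ->
  prob_size mu (S n) * prob_size mu (S m) <= mu 0%nat * prob_size mu (S (n + m)).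
Proof.
  intros Hmu. rewrite !prob_size_lsum.
  set (G := flat_map (fun t => map (graft t) (trees_of_size (S m))) (trees_of_size (S n))).
  transitivity (lsum (fun t => mu 0%nat * weight mu t) G).
  - right. unfold G. rewrite lsum_flat_map, <- lsum_scal_r. apply lsum_ext_in.
    intros t _. rewrite lsum_map, <- lsum_scal. apply lsum_ext_in.
    intros s _. symmetry; apply weight_graft.
  - rewrite lsum_scal. apply Rmult_le_compat_l; [auto|].
    apply lsum_incl; auto using weight_ge0.
    + apply NoDup_flat_map_intro; auto using NoDup_trees_of_size.
      * intros t Ht. apply NoDup_map_intro; auto using NoDup_trees_of_size.
        intros s s' Hs Hs' E. apply in_trees_of_size in Hs, Hs'.
        apply graft_inj in E; [tauto|congruence].
      * intros t t' x _ _ H H'. apply in_map_iff in H as (s & <- & Hs).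
        apply in_map_iff in H' as (s' & E & Hs'). apply in_trees_of_size in Hs, Hs'.
        apply graft_inj in E; [symmetry; tauto|congruence].
    + intros x Hx. apply in_flat_map in Hx as (t & Ht & Hx).
      apply in_map_iff in Hx as (s & <- & Hs).
      apply in_trees_of_size in Ht, Hs. apply in_trees_of_size.
      pose proof (tsize_graft t s). lia.
Qed.

Lemma weight_scal x mu t : weight (fun k => x * mu k) t = x ^ tsize t * weight mu t.
Proof.
  rewrite !weight_degs, lprod_mult, lprod_const, length_degs. reflexivity.
Qed.

(** The tangent of y^k at 1; averaged over a critical law it becomes G(y) >= 1 + (y - 1) = y. *)
Lemma bernoulli (y : R) k : 0 <= y -> 1 + INR k * (y - 1) <= y ^ k.
Proof.
  intros Hy. induction k as [|k IH]; [simpl; lra|].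
  rewrite S_INR. cbn [pow]. pose proof (pos_INR k).
  assert (y * (1 + INR k * (y - 1)) <= y * y ^ k) by (apply Rmult_le_compat_l; auto).
  pose proof (Rle_0_sqr (y - 1)). unfold Rsqr in *. nra.
Qed.

Definition gf (mu : nat -> R) (z : R) (N : nat) : R :=
  lsum (weight (fun k => z * mu k)) (trees_upto N).

(* The fixed point equation A = z G(A) and the tangent bound G(y) >= y, which is
   where criticality enters. *)
Lemma gf_growth mu z S0 : critical_offspring mu -> 0 <= z ->
  (forall N, gf mu z N <= S0) -> forall N, z * gf mu z N <= S0.
Proof.
  intros (Hmu & H1 & Hm) Hz Hb N. apply Rnot_lt_le. intros Hlt.
  set (y := gf mu z N) in *.
  assert (Hy : 0 <= y).
  { apply lsum_nonneg. intros t _. apply weight_ge0. intros k.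
    apply Rmult_le_pos; auto. }
  (* Truncating mass and mean up to [e] costs at most e (y + 2) in the tangent bound; the
     denominator keeps z times this cost below half of the gap z y - S0. *)
  set (e := (z * y - S0) / (2 * (z + 1) * (y + 2))).
  assert (Hd : 0 < 2 * (z + 1) * (y + 2)) by nra.
  assert (He : 0 < e) by (apply Rdiv_lt_0_compat; lra).
  assert (Hed : e * (2 * (z + 1) * (y + 2)) = z * y - S0) by (unfold e; field; nra).
  assert (Hkmu : forall k, 0 <= INR k * mu k)
    by (intros; apply Rmult_le_pos; auto using pos_INR).
  destruct (infinite_sum_partial_ge mu 1 e Hmu H1 He) as [K1 HK1].
  destruct (infinite_sum_partial_ge _ 1 e Hkmu Hm He) as [K2 HK2].
  set (B := (K1 + K2)%nat).
  specialize (HK1 B ltac:(unfold B; lia)). specialize (HK2 B ltac:(unfold B; lia)).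
  pose proof (infinite_sum_partial_le mu 1 B Hmu H1) as HL1.
  pose proof (infinite_sum_partial_le _ 1 B Hkmu Hm) as HL2.
  set (p := lsum mu (seq 0 B)) in *.
  set (q := lsum (fun k => INR k * mu k) (seq 0 B)) in *.
  assert (Hge : z * (p + (y - 1) * q) <= S0).
  { eapply Rle_trans; [|apply (Hb (S (B * N)))].
    eapply Rle_trans; [|apply (branching_sum_ge (fun k => z * mu k) _
      (weight (fun k => z * mu k)))].
    - unfold p, q. rewrite <- lsum_scal, <- lsum_plus, <- lsum_scal.
      apply lsum_le_in. intros k _. fold (gf mu z N). fold y.
      pose proof (bernoulli y k Hy).
      transitivity (z * mu k * (1 + INR k * (y - 1))); [right; ring|].
      apply Rmult_le_compat_l; auto. apply Rmult_le_pos; auto.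
    - intros; apply Rmult_le_pos; auto.
    - intros; apply weight_ge0. intros; apply Rmult_le_pos; auto.
    - intros; apply weight_Node. }
  (* The sign of y - 1 decides whether the lower or the upper bound on [q] is used. *)
  assert (y - e * (y + 2) <= p + (y - 1) * q) by (destruct (Rle_dec 1 y); nra).
  nra.
Qed.

Lemma lsum_geom_le r N : 0 <= r < 1 -> lsum (fun n => r ^ n) (seq 0 N) <= / (1 - r).
Proof.
  intros Hr. assert (lsum (fun n => r ^ n) (seq 0 N) * (1 - r) = 1 - r ^ N) as E.
  { induction N as [|N IH]; [unfold lsum; simpl; ring|].
    rewrite lsum_seq_S, Rmult_plus_distr_r, IH. cbn [pow]. ring. }
  assert (0 <= r ^ N) by (apply pow_le; lra).
  apply (Rmult_le_reg_r (1 - r)); [lra|]. rewrite Rinv_l; lra.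
Qed.

(** Otherwise A(z) would converge at some z > 1, and its supremum s > 0 would satisfy z s <= s. The
    index m = 0 is excluded because there the bound is a trivial equality. *)
Lemma prob_size_not_exp_small mu eta : critical_offspring mu -> 0 < mu 0%nat -> 0 < eta ->
  exists m, (1 <= m)%nat /\ mu 0%nat * exp (- (INR m * eta)) <= prob_size mu (S m).
Proof.
  intros Hc H0 Heta. apply NNPP. intros Hno.
  assert (Hup : forall m, prob_size mu (S m) <= mu 0%nat * exp (- (INR m * eta))).
  { intros [|m].
    - rewrite prob_size_1. simpl INR. rewrite Rmult_0_l, Ropp_0, exp_0. lra.
    - apply Rnot_lt_le. intros H. apply Hno. exists (S m). split; [lia|lra]. }
  pose proof Hc as (Hmu & _).
  (* Half of the assumed decay rate goes into z > 1; the other half leaves a geometric series of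
     ratio [r]. *)
  set (z := exp (eta / 2)). set (r := exp (- (eta / 2))).
  assert (Hz : 1 < z) by (unfold z; rewrite <- exp_0; apply exp_increasing; lra).
  assert (Hr : 0 <= r < 1).
  { split; [left; apply exp_pos|]. unfold r. rewrite <- exp_0. apply exp_increasing; lra. }
  assert (Hgf : forall N, gf mu z N = lsum (fun n => z ^ n * prob_size mu n) (seq 0 (S N))).
  { intros N. unfold gf, trees_upto. rewrite lsum_flat_map. apply lsum_ext_in.
    intros n _. rewrite prob_size_lsum, <- lsum_scal. apply lsum_ext_in.
    intros t Ht. apply in_trees_of_size in Ht. rewrite weight_scal. now rewrite Ht. }
  assert (Hterm : forall n, z ^ n * prob_size mu n <= mu 0%nat * z * z * r ^ n).
  { intros [|n].
    - unfold prob_size; simpl. nra.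
    - transitivity (z ^ S n * (mu 0%nat * exp (- (INR n * eta)))).
      + apply Rmult_le_compat_l; [apply pow_le; lra|apply Hup].
      + right. unfold z, r. rewrite !exp_pow.
        transitivity (mu 0%nat * exp (INR (S n) * (eta / 2) + - (INR n * eta)));
          [rewrite exp_plus; ring|].
        rewrite !Rmult_assoc, <- !exp_plus. f_equal. f_equal. rewrite S_INR. field. }
  assert (Hbd : forall N, gf mu z N <= mu 0%nat * z * z * / (1 - r)).
  { intros N. rewrite Hgf.
    eapply Rle_trans; [apply lsum_le_in; intros; apply Hterm|].
    rewrite lsum_scal. apply Rmult_le_compat_l; [nra|]. now apply lsum_geom_le. }
  destruct (completeness (fun y => exists N, y = gf mu z N)) as [s [Hub Hlub]].
  { exists (mu 0%nat * z * z * / (1 - r)). intros y [N ->]. apply Hbd. }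
  { exists (gf mu z 0). now exists 0%nat. }
  assert (Hs : forall N, gf mu z N <= s) by (intros N; apply Hub; now exists N).
  assert (Hs0 : 0 < s).
  { apply Rlt_le_trans with (gf mu z 1); [|apply Hs].
    rewrite Hgf. unfold lsum; simpl. rewrite prob_size_1. unfold prob_size; simpl. nra. }
  pose proof (gf_growth mu z s Hc ltac:(lra) Hs) as Hg.
  (* By [gf_growth], applied with the supremum [s] itself as bound, s / z is again an upper bound of
     all partial sums. *)
  assert (Hle : s <= s / z).
  { apply Hlub. intros y [N ->]. specialize (Hg N).
    apply (Rmult_le_reg_l z); [lra|]. replace (z * (s / z)) with s by (field; lra). lra. }
  assert (z * s <= s).
  { apply (Rmult_le_compat_l z) in Hle; [|lra].
    replace (z * (s / z)) with s in Hle by (field; lra). lra. }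
  nra.
Qed.

Lemma least_nat (P : nat -> Prop) :
  (exists n, P n) -> exists n, P n /\ forall m, P m -> (n <= m)%nat.
Proof.
  intros [n Hn]. apply NNPP. intros Hno.
  assert (H : forall k m, (m < k)%nat -> ~ P m).
  { induction k as [|k IH]; [lia|]. intros m Hm Pm. apply Hno. exists m.
    split; [assumption|]. intros j Pj. destruct (Nat.le_gt_cases m j); [assumption|].
    exfalso. apply (IH j); [lia|assumption]. }
  apply (H (S n) n); auto.
Qed.

(* A Fekete argument: one good m propagates along each residue class mod m. *)
Lemma supermult_exp_lower (c : nat -> R) eta m :
  (forall i j, c i * c j <= c (i + j)%nat) -> (1 <= m)%nat ->
  exp (- (INR m * eta)) <= c m -> 0 < eta ->
  exists kap, 0 < kap /\ forall n, 0 < c n -> kap * exp (- (INR n * eta)) <= c n.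
Proof.
  intros Hsup Hm Hcm Heta.
  assert (Hmul : forall j i, 0 < c i -> c i * exp (- (INR (j * m) * eta)) <= c (i + j * m)%nat).
  { induction j as [|j IH]; intros i Hi.
    - simpl. rewrite Rmult_0_l, Ropp_0, exp_0, Nat.add_0_r. lra.
    - replace (i + S j * m)%nat with ((i + j * m) + m)%nat by lia.
      eapply Rle_trans; [|apply Hsup]. specialize (IH i Hi).
      replace (S j * m)%nat with (j * m + m)%nat by lia.
      replace (- (INR (j * m + m) * eta))
        with (- (INR (j * m) * eta) + - (INR m * eta)) by (rewrite plus_INR; ring).
      rewrite exp_plus, <- Rmult_assoc.
      apply Rmult_le_compat; auto; [|left; apply exp_pos].
      apply Rmult_le_pos; [lra|left; apply exp_pos]. }
  (* Induction over the residue classes: each one that contains an admissible index contributes the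
     value of [c] at its least such index, and [kap] is the minimum of these finitely many values
     and 1. *)
  assert (HR : forall r, exists kap, 0 < kap /\ forall n, (n mod m < r)%nat -> 0 < c n ->
    kap * exp (- (INR n * eta)) <= c n).
  { induction r as [|r (kap & Hk & IH)].
    - exists 1. split; [lra|]. intros; lia.
    - destruct (classic (exists n, n mod m = r /\ 0 < c n)) as [Hex|Hne].
      + destruct (least_nat _ Hex) as (n0 & [Hn0 Hc0] & Hmin).
        exists (Rmin kap (c n0)). split; [now apply Rmin_glb_lt|].
        intros n Hn Hcn. pose proof (exp_pos (- (INR n * eta))).
        destruct (Nat.eq_dec (n mod m) r) as [E|E].
        * assert (Hnn : (n0 <= n)%nat) by (apply Hmin; auto).
          assert (exists j, n = n0 + j * m)%nat as [j ->].
          { exists (n / m - n0 / m)%nat.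
            pose proof (Nat.div_mod_eq n m). pose proof (Nat.div_mod_eq n0 m).
            assert (n0 / m <= n / m)%nat by (apply Nat.Div0.div_le_mono; lia).
            rewrite Nat.mul_sub_distr_r. nia. }
          eapply Rle_trans; [|apply Hmul, Hc0].
          apply Rmult_le_compat; [apply Rmin_glb; lra|lra|apply Rmin_r|].
          apply exp_le_compat. rewrite plus_INR. pose proof (pos_INR n0). nra.
        * eapply Rle_trans; [|apply IH; [lia|assumption]].
          apply Rmult_le_compat_r; [lra|apply Rmin_l].
      + exists kap. split; [assumption|]. intros n Hn Hcn. apply IH; [|assumption].
        destruct (Nat.eq_dec (n mod m) r); [|lia]. exfalso. apply Hne. eauto. }
  destruct (HR m) as (kap & Hk & H). exists kap. split; [assumption|].
  intros n. apply H. apply Nat.mod_upper_bound. lia.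
Qed.

Lemma exists_nat_ge x : exists N, x <= INR N.
Proof.
  destruct (INR_unbounded x) as [N HN]. exists N. lra.
Qed.

(** The Fekete bound is used at rate eta / 2, so that the remaining factor exp(-n eta / 2) swallows
    the constant [kap * mu 0] for large n. *)
Lemma prob_size_subexp mu eta : critical_offspring mu -> 0 < mu 0%nat -> 0 < eta ->
  exists N, forall n, (N <= n)%nat -> 0 < prob_size mu n ->
    exp (- (INR n * eta)) <= prob_size mu n.
Proof.
  intros Hc H0 Heta. pose proof Hc as (Hmu & _).
  destruct (prob_size_not_exp_small mu (eta / 2) Hc H0 ltac:(lra)) as (m & Hm & Hpm).
  destruct (supermult_exp_lower (fun n => prob_size mu (S n) / mu 0%nat) (eta / 2) m)
    as (kap & Hk & H); auto; try lra.
  { intros i j. pose proof (prob_size_supermult mu i j Hmu).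
    apply (Rmult_le_reg_r (mu 0%nat * mu 0%nat)); [nra|].
    replace (prob_size mu (S i) / mu 0%nat * (prob_size mu (S j) / mu 0%nat)
             * (mu 0%nat * mu 0%nat))
      with (prob_size mu (S i) * prob_size mu (S j)) by (field; lra).
    replace (prob_size mu (S (i + j)) / mu 0%nat * (mu 0%nat * mu 0%nat))
      with (mu 0%nat * prob_size mu (S (i + j))) by (field; lra). assumption. }
  { apply (Rmult_le_reg_l (mu 0%nat)); [assumption|].
    replace (mu 0%nat * (prob_size mu (S m) / mu 0%nat)) with (prob_size mu (S m))
      by (field; lra). assumption. }
  destruct (exists_nat_ge (- ln (kap * mu 0%nat) / (eta / 2))) as [N HN].
  exists (S N). intros [|n] Hn Hp; [lia|].
  specialize (H n ltac:(apply Rdiv_lt_0_compat; assumption)).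
  apply (Rmult_le_compat_l (mu 0%nat)) in H; [|lra].
  replace (mu 0%nat * (prob_size mu (S n) / mu 0%nat)) with (prob_size mu (S n)) in H
    by (field; lra).
  eapply Rle_trans; [|apply H].
  assert (Hkm : 0 < kap * mu 0%nat) by nra.
  rewrite <- Rmult_assoc, (Rmult_comm (mu 0%nat) kap), <- (exp_ln _ Hkm), <- exp_plus.
  apply exp_le_compat. apply (Rmult_le_compat_r (eta / 2)) in HN; [|lra].
  replace (- ln (kap * mu 0%nat) / (eta / 2) * (eta / 2)) with (- ln (kap * mu 0%nat)) in HN
    by (field; lra).
  assert (INR N <= INR n) by (apply le_INR; lia). rewrite S_INR. nra.
Qed.

(** * Exponentially unlikely events *)

(** The total mass is the least solution of the branching equation, hence lies below every
    supersolution; the proof is induction on the size bound. [v] need not have mass 1. *)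
Lemma weight_sum_le v y N : (forall k, 0 <= v k) -> 0 <= y ->
  (forall B, lsum (fun k => v k * y ^ k) (seq 0 B) <= y) ->
  lsum (weight v) (trees_upto N) <= y.
Proof.
  intros Hv Hy H. induction N as [|N IH]; [assumption|].
  eapply Rle_trans; [apply (branching_sum_le v _ (weight v)); auto using weight_Node|].
  { intros; now apply weight_ge0. }
  eapply Rle_trans; [|apply (H (S N))]. apply lsum_le_in. intros k _.
  apply Rmult_le_compat_l; auto. apply pow_incr. split; [|assumption].
  apply lsum_nonneg. intros; now apply weight_ge0.
Qed.

(** Vertices at depth below k are weighted by [v], each subtree rooted at depth k by [g0]. *)
Fixpoint biter (v : nat -> R) (g0 : tree -> R) (k : nat) (t : tree) : R :=
  match k, t with
  | O, _ => g0 t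
  | S k', Node f => v (length f) * lprod (biter v g0 k') f
  end.

Lemma biter_ge0 v g0 k t : (forall j, 0 <= v j) -> (forall t, 0 <= g0 t) ->
  0 <= biter v g0 k t.
Proof.
  intros Hv Hg. revert t. induction k as [|k IH]; intros [f]; cbn [biter]; auto.
  apply Rmult_le_pos; auto. apply lprod_nonneg; auto.
Qed.

Lemma biter_sum_le v g0 (y : nat -> R) h : (forall k, 0 <= v k) -> (forall t, 0 <= g0 t) ->
  (forall k, 0 <= y k) -> (forall N, lsum g0 (trees_upto N) <= y 0%nat) ->
  (forall k B, (k < h)%nat -> lsum (fun j => v j * y k ^ j) (seq 0 B) <= y (S k)) ->
  forall k N, (k <= h)%nat -> lsum (biter v g0 k) (trees_upto N) <= y k.
Proof.
  intros Hv Hg Hy H0 HS. induction k as [|k IH]; intros N Hk; [apply H0|].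
  destruct N as [|N]; [apply Hy|].
  eapply Rle_trans; [apply (branching_sum_le v _ (biter v g0 k)); auto using biter_ge0|].
  eapply Rle_trans; [|apply (HS k (S N)); lia]. apply lsum_le_in. intros j _.
  apply Rmult_le_compat_l; auto. apply pow_incr. split; [|apply IH; lia].
  apply lsum_nonneg; auto using biter_ge0.
Qed.

(** Degrees above K are sent to 0, not to K, so that the truncated mean is a partial sum of the
    series for the mean. *)
Definition cap (K k : nat) : nat := if (k <=? K)%nat then k else 0%nat.

Lemma cap_le_l K k : (cap K k <= k)%nat.
Proof. unfold cap. destruct (Nat.leb_spec k K); lia. Qed.

Lemma cap_le_r K k : (cap K k <= K)%nat.
Proof. unfold cap. destruct (Nat.leb_spec k K); lia. Qed.

Lemma exp_opp_le y : 0 <= y -> exp (- y) <= 1 - y + y * y.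
Proof.
  intros Hy. rewrite exp_Ropp. pose proof (exp_ineq1_le y) as H.
  apply (Rmult_le_reg_r (exp y)); [apply exp_pos|].
  rewrite Rinv_l by (pose proof (exp_pos y); lra).
  (* The product is 1 + y^3. *)
  transitivity ((1 - y + y * y) * (1 + y)); [nra|]. apply Rmult_le_compat_l; nra.
Qed.

(** Expand exp(-u) <= 1 - u + u^2 at u = lam [cap K k]. One [eps] is lost in the truncated mean; the
    other bounds the quadratic term, at most lam^2 K^2 <= lam eps. *)
Lemma laplace_le nu K eps lam B : (forall k, 0 <= nu k) ->
  (forall B, lsum nu (seq 0 B) <= 1) ->
  1 - eps <= lsum (fun k => nu k * INR (cap K k)) (seq 0 (S K)) ->
  0 <= lam -> lam * (INR K * INR K) <= eps ->
  lsum (fun k => nu k * exp (- (lam * INR (cap K k)))) (seq 0 B)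
    <= exp (- (lam * (1 - 2 * eps))).
Proof.
  intros Hnu H1 Hm Hl Hle. set (B' := (B + S K)%nat).
  assert (Hcap : forall k, 0 <= INR (cap K k) <= INR K).
  { intros k. split; [apply pos_INR|]. apply le_INR, cap_le_r. }
  transitivity (lsum (fun k => nu k * exp (- (lam * INR (cap K k)))) (seq 0 B')).
  { apply lsum_seq_mono; [|unfold B'; lia].
    intros k; apply Rmult_le_pos; [auto|left; apply exp_pos]. }
  transitivity (lsum (fun k => (1 + lam * eps) * nu k - lam * (nu k * INR (cap K k))) (seq 0 B')).
  { apply lsum_le_in. intros k _. specialize (Hcap k).
    pose proof (exp_opp_le (lam * INR (cap K k)) ltac:(nra)) as He.
    transitivity (nu k * (1 - lam * INR (cap K k) + lam * eps)); [|right; ring].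
    apply Rmult_le_compat_l; auto. eapply Rle_trans; [apply He|].
    apply Rplus_le_compat_l.
    transitivity (lam * (lam * (INR K * INR K))); [|now apply Rmult_le_compat_l].
    replace (lam * INR (cap K k) * (lam * INR (cap K k)))
      with (lam * (lam * (INR (cap K k) * INR (cap K k)))) by ring.
    do 2 (apply Rmult_le_compat_l; [assumption|]). apply Rmult_le_compat; tauto. }
  set (m := lsum (fun k => nu k * INR (cap K k)) (seq 0 B')).
  assert (Hm' : 1 - eps <= m).
  { eapply Rle_trans; [apply Hm|]. apply lsum_seq_mono; [|unfold B'; lia].
    intros k; apply Rmult_le_pos; [auto|apply pos_INR]. }
  transitivity ((1 + lam * eps) * lsum nu (seq 0 B') - lam * m).
  { right. unfold m. rewrite <- !lsum_scal. unfold Rminus.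
    rewrite <- (Rmult_1_l (lsum (fun a => lam * _) _)), Ropp_mult_distr_l, <- lsum_scal.
    rewrite <- lsum_plus. apply lsum_ext_in; intros; ring. }
  eapply Rle_trans; [|apply exp_ineq1_le]. specialize (H1 B').
  assert (0 <= eps) by (pose proof (pos_INR K); nra).
  assert ((1 + lam * eps) * lsum nu (seq 0 B') <= 1 + lam * eps).
  { rewrite <- (Rmult_1_r (1 + lam * eps)) at 2. apply Rmult_le_compat_l; nra. }
  assert (lam * (1 - eps) <= lam * m) by (apply Rmult_le_compat_l; lra). lra.
Qed.

(** For s = exp(-lam) close to 1 this reads G(s) <= s^(1 - 2 eps), almost a supersolution at s. *)
Lemma laplace_pow_le nu K eps lam B : (forall k, 0 <= nu k) ->
  (forall B, lsum nu (seq 0 B) <= 1) ->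
  1 - eps <= lsum (fun k => nu k * INR (cap K k)) (seq 0 (S K)) ->
  0 <= lam -> lam * (INR K * INR K) <= eps ->
  lsum (fun k => nu k * exp (- lam) ^ k) (seq 0 B) <= exp (- (lam * (1 - 2 * eps))).
Proof.
  intros Hnu H1 Hm Hl Hle. eapply Rle_trans; [|eapply laplace_le; eassumption].
  apply lsum_le_in. intros k _. apply Rmult_le_compat_l; auto. rewrite exp_pow.
  apply exp_le_compat. pose proof (le_INR _ _ (cap_le_l K k)). nra.
Qed.

Lemma critical_cap mu eps : critical_offspring mu -> 0 < eps ->
  exists K, (1 <= K)%nat /\
    1 - eps <= lsum (fun k => mu k * INR (cap K k)) (seq 0 (S K)).
Proof.
  intros (Hmu & _ & Hm) He.
  destruct (infinite_sum_partial_ge _ 1 eps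
    (fun k => Rmult_le_pos _ _ (pos_INR k) (Hmu k)) Hm He) as [K HK].
  exists (S K). split; [lia|]. specialize (HK (S (S K)) ltac:(lia)).
  rewrite (lsum_ext_in _ (fun k => INR k * mu k)); [lra|].
  intros k Hk. apply in_seq in Hk. unfold cap. destruct (Nat.leb_spec k (S K)); [ring|lia].
Qed.

Lemma lprod_pow {A} (a : R) (h : A -> nat) l :
  lprod (fun c => a ^ h c) l = a ^ list_sum (map h l).
Proof.
  induction l as [|c l IH]; [reflexivity|].
  rewrite lprod_cons, IH. cbn [map]. change (list_sum (h c :: map h l)) with (h c + list_sum (map h l))%nat.
  now rewrite pow_add.
Qed.

(** Each of the [gen k t] subtrees at depth k contributes 1 / s. Above that depth [biter] carries
    [mu] without the factor x <= 1, whence an inequality. *)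
Lemma biter_gen_ge mu x s k t : (forall j, 0 <= mu j) -> 0 <= x <= 1 -> 0 < s ->
  weight (fun j => x * mu j) t * (/ s) ^ gen k t
    <= biter mu (fun t => weight (fun j => x * mu j) t / s) k t.
Proof.
  intros Hmu Hx Hs. pose proof (Rinv_0_lt_compat s Hs).
  assert (Hw : forall c, 0 <= weight (fun j => x * mu j) c).
  { intros; apply weight_ge0. intros; apply Rmult_le_pos; [lra|auto]. }
  revert t. induction k as [|k IH]; intros [f]; cbn [biter gen].
  - rewrite pow_1. unfold Rdiv. lra.
  - rewrite weight_Node, <- lprod_pow, Rmult_assoc, <- lprod_mult.
    assert (Hp : 0 <= lprod (fun a => weight (fun j => x * mu j) a * (/ s) ^ gen k a) f).
    { apply lprod_nonneg. intros c _. apply Rmult_le_pos; auto. apply pow_le; lra. }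
    apply Rmult_le_compat; auto.
    + apply Rmult_le_pos; [lra|auto].
    + specialize (Hmu (length f)). nra.
    + apply lprod_le_in. intros c _. split; [|apply IH].
      apply Rmult_le_pos; auto. apply pow_le; lra.
Qed.

(* With s = exp (- lam) and x = exp (- lam delta / 2) one has x G(s) <= s, so that
   x^(number of vertices at depth >= k) s^(- Z_k) has mean at most 1; on the event
   Z_k > delta n it is at least exp (lam delta n / 2). *)
Lemma large_gen_exp_small mu delta : critical_offspring mu -> 0 < delta ->
  exists c, 0 < c /\ forall n k,
    lsum (fun t => if Rlt_dec (delta * INR n) (INR (gen k t)) then weight mu t else 0)
      (trees_of_size n) <= exp (- (c * INR n)).
Proof.
  intros Hc Hd. pose proof Hc as (Hmu & H1 & _).
  (* The Laplace bound loses twice this, so the exponent falls short by lam delta / 2, which the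
     factor [x] restores exactly. *)
  destruct (critical_cap mu (delta / 4) Hc ltac:(lra)) as (K & HK & Hm).
  assert (HKR : 1 <= INR K) by (apply (le_INR 1); lia).
  set (lam := delta / 4 / (INR K * INR K)).
  assert (Hlam : 0 < lam) by (unfold lam; apply Rdiv_lt_0_compat; nra).
  assert (Hlk : lam * (INR K * INR K) = delta / 4) by (unfold lam; field; nra).
  assert (Hsub : forall B, lsum mu (seq 0 B) <= 1)
    by (intros; now apply infinite_sum_partial_le).
  set (s := exp (- lam)). set (x := exp (- (lam * delta / 2))).
  assert (Hs : 0 < s) by apply exp_pos.
  assert (Hx : 0 < x) by apply exp_pos.
  assert (Hx1 : x <= 1) by (unfold x; rewrite <- exp_0; apply exp_le_compat; nra).
  assert (Hxmu : forall j, 0 <= x * mu j) by (intros; apply Rmult_le_pos; [lra|auto]).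
  exists (lam * delta / 2). split; [nra|]. intros n k.
  assert (Hw : forall N, lsum (weight (fun j => x * mu j)) (trees_upto N) <= s).
  { intros N. apply weight_sum_le; auto; [lra|]. intros B.
    rewrite (lsum_ext_in _ (fun j => x * (mu j * s ^ j))) by (intros; ring).
    rewrite lsum_scal.
    transitivity (x * exp (- (lam * (1 - 2 * (delta / 4))))).
    - apply Rmult_le_compat_l; [lra|]. unfold s. eapply laplace_pow_le; eauto; lra.
    - right. unfold x, s. rewrite <- exp_plus. f_equal. field. }
  set (g0 := fun t => weight (fun j => x * mu j) t / s).
  assert (Hg0 : forall t, 0 <= g0 t).
  { intros t. apply Rmult_le_pos; [now apply weight_ge0|]. left; now apply Rinv_0_lt_compat. }
  assert (Hg : lsum (biter mu g0 k) (trees_upto n) <= 1).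
  (* Dividing by [s] brings the subtrees at depth k to mass at most 1, and G(1) <= 1 carries this up
     to the root. *)
  { apply (biter_sum_le mu g0 (fun _ => 1) k); auto; [intros; lra| |].
    - intros N. unfold g0, Rdiv.
      rewrite (lsum_scal_r (/ s) (weight (fun j => x * mu j))).
      apply (Rmult_le_reg_r s); [assumption|]. rewrite Rmult_assoc, Rinv_l, !Rmult_1_r, Rmult_1_l by lra.
      apply Hw.
    - intros j B _. rewrite (lsum_ext_in _ mu) by (intros; rewrite pow1; ring). apply Hsub. }
  pose proof (lsum_trees_of_size_le _ n (fun t => biter_ge0 mu g0 k t Hmu Hg0)) as Hn.
  set (c := lam * delta / 2 * INR n).
  assert (Hmain : exp c * lsum (fun t => if Rlt_dec (delta * INR n) (INR (gen k t))
      then weight mu t else 0) (trees_of_size n) <= 1).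
  { rewrite <- lsum_scal. eapply Rle_trans; [|eapply Rle_trans; [apply Hn|apply Hg]].
    apply lsum_le_in. intros t Ht. apply in_trees_of_size in Ht.
    destruct (Rlt_dec (delta * INR n) (INR (gen k t))) as [Hlt|_];
      [|rewrite Rmult_0_r; now apply biter_ge0].
    eapply Rle_trans; [|apply biter_gen_ge; auto; lra].
    rewrite weight_scal, Ht.
    rewrite (Rmult_comm (x ^ n)), Rmult_assoc, Rmult_comm.
    apply Rmult_le_compat_l; [now apply weight_ge0|].
    unfold x, s. rewrite <- exp_Ropp, !exp_pow, <- exp_plus. apply exp_le_compat.
    unfold c. nra. }
  apply (Rmult_le_reg_l (exp c)); [apply exp_pos|].
  rewrite <- exp_plus. replace (c + - c) with 0 by ring. now rewrite exp_0.
Qed.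

Definition capdeg (K : nat) (t : tree) : R := lsum (fun k => INR (cap K k)) (degs t).

(** A Chernoff bound for the degrees: tilting [mu] by exp(lam (1 - eps / 2) - lam [cap K k]) keeps
    its mass at most 1, so y = 1 is a supersolution, and on the event the tilt is at least exp(lam
    eps n / 2). *)
Lemma small_capdeg_exp_small mu eps : critical_offspring mu -> 0 < eps ->
  exists K c, (1 <= K)%nat /\ 0 < c /\ forall n,
    lsum (fun t => if Rlt_dec (capdeg K t) ((1 - eps) * INR n) then weight mu t else 0)
      (trees_of_size n) <= exp (- (c * INR n)).
Proof.
  intros Hc He. pose proof Hc as (Hmu & H1 & _).
  destruct (critical_cap mu (eps / 4) Hc ltac:(lra)) as (K & HK & Hm).
  assert (HKR : 1 <= INR K) by (apply (le_INR 1); lia).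
  set (lam := eps / 4 / (INR K * INR K)).
  assert (Hlam : 0 < lam) by (unfold lam; apply Rdiv_lt_0_compat; nra).
  assert (Hlk : lam * (INR K * INR K) = eps / 4) by (unfold lam; field; nra).
  assert (Hsub : forall B, lsum mu (seq 0 B) <= 1)
    by (intros; now apply infinite_sum_partial_le).
  exists K, (lam * eps / 2). split; [assumption|]. split; [nra|]. intros n.
  set (e := fun k => exp (lam * (1 - eps / 2) + - lam * INR (cap K k))).
  set (v := fun k => mu k * e k).
  assert (Hv : forall k, 0 <= v k)
    by (intros; apply Rmult_le_pos; [auto|left; apply exp_pos]).
  assert (Hw : lsum (weight v) (trees_upto n) <= 1).
  { apply weight_sum_le; auto; [lra|]. intros B.
    rewrite (lsum_ext_in _ (fun k => exp (lam * (1 - eps / 2))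
      * (mu k * exp (- (lam * INR (cap K k)))))).
    2:{ intros k _. rewrite pow1. unfold v, e. rewrite exp_plus.
        replace (- lam * INR (cap K k)) with (- (lam * INR (cap K k))) by ring. ring. }
    rewrite lsum_scal.
    eapply Rle_trans.
    - apply Rmult_le_compat_l; [left; apply exp_pos|].
      apply (laplace_le mu K (eps / 4) lam); auto; lra.
    - right. rewrite <- exp_plus, <- exp_0. f_equal. field. }
  pose proof (lsum_trees_of_size_le _ n (fun t => weight_ge0 v t Hv)) as Hn.
  set (c := lam * eps / 2 * INR n).
  assert (Hmain : exp c * lsum (fun t => if Rlt_dec (capdeg K t) ((1 - eps) * INR n)
      then weight mu t else 0) (trees_of_size n) <= 1).
  { rewrite <- lsum_scal. eapply Rle_trans; [|eapply Rle_trans; [apply Hn|apply Hw]].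
    apply lsum_le_in. intros t Ht. apply in_trees_of_size in Ht.
    destruct (Rlt_dec (capdeg K t) ((1 - eps) * INR n)) as [Hlt|_];
      [|rewrite Rmult_0_r; now apply weight_ge0].
    rewrite (weight_degs v). unfold v. rewrite lprod_mult, <- weight_degs, Rmult_comm.
    apply Rmult_le_compat_l; [now apply weight_ge0|].
    unfold e. rewrite lprod_exp. apply exp_le_compat.
    rewrite lsum_plus, lsum_const, lsum_scal, length_degs, Ht.
    fold (capdeg K t). unfold c. apply Rlt_le in Hlt.
    apply (Rmult_le_compat_l lam) in Hlt; [|lra]. lra. }
  apply (Rmult_le_reg_l (exp c)); [apply exp_pos|].
  rewrite <- exp_plus. replace (c + - c) with 0 by ring. now rewrite exp_0.
Qed.

(** [g0] is consulted only at vertices of depth h, and such a tree has none. *)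
Lemma height_lt_biter v h t : (height t < h)%nat -> biter v (fun _ => 0) h t = weight v t.
Proof.
  revert t. induction h as [|h IH]; intros [f] Hh; [lia|].
  cbn [biter]. rewrite weight_Node. f_equal. apply lprod_ext_in. intros c Hcf. apply IH.
  cbn [height] in Hh.
  enough (S (height c) <= fold_right (fun c m => Nat.max (S (height c)) m) 0 f)%nat by lia.
  clear Hh. induction f as [|d f IHf]; [destruct Hcf|]. cbn [fold_right].
  destruct Hcf as [->|Hcf]; [lia|]. specialize (IHf Hcf). lia.
Qed.

(** With y_k = exp(-lam r^k), the Laplace bound gives G(y_k) <= y_(k+1) exp(-eps lam r^k). For k < h
    the last factor pays for an extra weight x = exp(eps lam r^h) on every vertex, so x^n times the
    mass of short trees of size n is at most 1. *)
Lemma short_trees_exp_small nu K eps lam r h n : (forall k, 0 <= nu k) ->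
  (forall B, lsum nu (seq 0 B) <= 1) ->
  1 - eps <= lsum (fun k => nu k * INR (cap K k)) (seq 0 (S K)) ->
  0 <= lam -> lam * (INR K * INR K) <= eps -> r = 1 - 3 * eps -> 0 <= r <= 1 ->
  lsum (fun t => if (height t <? h)%nat then weight nu t else 0) (trees_of_size n)
    <= exp (- (eps * lam * r ^ h * INR n)).
Proof.
  intros Hnu Hsub Hm Hlam Hlk Hr Hr1. set (b := eps * lam * r ^ h).
  set (x := exp b). set (v := fun k => x * nu k).
  assert (Hx : 0 < x) by apply exp_pos.
  assert (Hv : forall k, 0 <= v k) by (intros; apply Rmult_le_pos; [lra|auto]).
  assert (Hrk : forall k, 0 <= r ^ k <= 1).
  { intros k. split; [apply pow_le; lra|]. rewrite <- (pow1 k). apply pow_incr; lra. }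
  assert (Heps : 0 <= eps) by lra.
  assert (Hg : lsum (biter v (fun _ => 0) h) (trees_upto n) <= 1).
  { transitivity (exp (- (lam * r ^ h))).
    - apply (biter_sum_le v _ (fun k => exp (- (lam * r ^ k))) h); auto; try (intros; lra).
      + intros; left; apply exp_pos.
      + intros N. rewrite lsum_const, Rmult_0_r. left; apply exp_pos.
      + intros k B Hk. unfold v.
        rewrite (lsum_ext_in _ (fun j => x * (nu j * exp (- (lam * r ^ k)) ^ j)))
          by (intros; ring).
        rewrite lsum_scal. specialize (Hrk k) as Hk1.
        transitivity (x * exp (- (lam * r ^ k * (1 - 2 * eps)))).
        * apply Rmult_le_compat_l; [lra|]. eapply laplace_pow_le; eauto; [nra|].
          pose proof (pos_INR K). nra.
        * unfold x. rewrite <- exp_plus. apply exp_le_compat. cbn [pow].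
          assert (r ^ h <= r ^ k).
          { replace h with (k + (h - k))%nat by lia. rewrite pow_add.
            pose proof (Hrk (h - k)%nat). nra. }
          assert (b <= eps * lam * r ^ k).
          { apply Rmult_le_compat_l; [nra|assumption]. }
          nra.
    - rewrite <- exp_0. apply exp_le_compat. specialize (Hrk h). nra. }
  pose proof (lsum_trees_of_size_le _ n
    (fun t => biter_ge0 v (fun _ => 0) h t Hv (fun _ => Rle_refl 0))) as Hn.
  assert (Hmain : exp (b * INR n) * lsum (fun t => if (height t <? h)%nat
      then weight nu t else 0) (trees_of_size n) <= 1).
  { rewrite <- lsum_scal. eapply Rle_trans; [|eapply Rle_trans; [apply Hn|apply Hg]].
    apply lsum_le_in. intros t Ht. apply in_trees_of_size in Ht.
    destruct (Nat.ltb_spec (height t) h) as [Hlt|_];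
      [|rewrite Rmult_0_r; apply biter_ge0; auto; intros; lra].
    rewrite height_lt_biter by assumption. unfold v. rewrite weight_scal, Ht.
    unfold x. rewrite exp_pow. right. f_equal. f_equal. ring. }
  apply (Rmult_le_reg_l (exp (b * INR n))); [apply exp_pos|].
  rewrite <- exp_plus. replace (b * INR n + - (b * INR n)) with 0 by ring. now rewrite exp_0.
Qed.

(** * Counting trees with given degrees *)

Local Notation cnt w k := (count_occ Nat.eq_dec w k).

(** Used when one vertex is added to or removed from a degree count. *)
Lemma lsum_upd (f g : nat -> R) l k a : NoDup l -> In k l ->
  f k = a + g k -> (forall i, i <> k -> f i = g i) -> lsum f l = a + lsum g l.
Proof.
  intros Hl Hk Hfk Hf. induction l as [|b l IH]; [destruct Hk|].
  inversion Hl; subst. rewrite !lsum_cons. destruct Hk as [->|Hk].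
  - rewrite Hfk, (lsum_ext_in f g l); [lra|]. intros i Hi. apply Hf. now intros ->.
  - rewrite IH by assumption. rewrite (Hf b) by (now intros ->). lra.
Qed.

Lemma lprod_upd (f g : nat -> R) l k a : NoDup l -> In k l ->
  f k = a * g k -> (forall i, i <> k -> f i = g i) -> lprod f l = a * lprod g l.
Proof.
  intros Hl Hk Hfk Hf. induction l as [|b l IH]; [destruct Hk|].
  inversion Hl; subst. rewrite !lprod_cons. destruct Hk as [->|Hk].
  - rewrite Hfk, (lprod_ext_in f g l); [ring|]. intros i Hi. apply Hf. now intros ->.
  - rewrite IH by assumption. rewrite (Hf b) by (now intros ->). ring.
Qed.

Lemma lsum_cnt (c : nat -> R) w B : (forall k, In k w -> (k < B)%nat) ->
  lsum c w = lsum (fun k => c k * INR (cnt w k)) (seq 0 B).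
Proof.
  induction w as [|a w IH]; intros Hw.
  - symmetry. rewrite (lsum_ext_in _ (fun _ => 0)); [rewrite lsum_const; unfold lsum; simpl; ring|].
    intros; simpl; ring.
  - rewrite lsum_cons, IH by (intros; apply Hw; now right). symmetry.
    apply (lsum_upd _ _ _ a); [apply seq_NoDup|apply in_seq; split; [lia|apply Hw; now left]| |].
    + rewrite count_occ_cons_eq, S_INR by reflexivity. ring.
    + intros i Hi. rewrite count_occ_cons_neq by congruence. reflexivity.
Qed.

Lemma lprod_cnt (c : nat -> R) w B : (forall k, In k w -> (k < B)%nat) ->
  lprod c w = lprod (fun k => c k ^ cnt w k) (seq 0 B).
Proof.
  induction w as [|a w IH]; intros Hw.
  - symmetry. rewrite (lprod_ext_in _ (fun _ => 1)); [rewrite lprod_const, pow1; reflexivity|].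
    intros; reflexivity.
  - rewrite lprod_cons, IH by (intros; apply Hw; now right). symmetry.
    apply (lprod_upd _ _ _ a); [apply seq_NoDup|apply in_seq; split; [lia|apply Hw; now left]| |].
    + rewrite count_occ_cons_eq by reflexivity. reflexivity.
    + intros i Hi. rewrite count_occ_cons_neq by congruence. reflexivity.
Qed.

Lemma INR_list_sum w : INR (list_sum w) = lsum INR w.
Proof.
  induction w as [|a w IH]; [reflexivity|]. rewrite lsum_cons, <- IH, <- plus_INR. reflexivity.
Qed.

Lemma INR_length {A} (l : list A) : INR (length l) = lsum (fun _ => 1) l.
Proof. rewrite lsum_const; ring. Qed.

Definition dec_at (k : nat) (tau : nat -> nat) (i : nat) : nat :=
  if (i =? k)%nat then pred (tau i) else tau i.

Lemma dec_at_eq k tau : dec_at k tau k = pred (tau k).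
Proof. unfold dec_at. now rewrite Nat.eqb_refl. Qed.

Lemma dec_at_neq k tau i : i <> k -> dec_at k tau i = tau i.
Proof. intros H. unfold dec_at. destruct (Nat.eqb_spec i k); [contradiction|reflexivity]. Qed.

Definition add_root (k : nat) (q : list tree) : list tree :=
  Node (firstn k q) :: skipn k q.

(* Forests in which exactly [tau k] vertices have [k] children: deleting the first
   root of a forest and keeping its [k] children as roots decreases [tau k] by one. *)
Fixpoint forests_of_type (B n : nat) (tau : nat -> nat) : list (list tree) :=
  match n with
  | O => [[]]
  | S n' =>
      flat_map (fun k =>
        if (tau k =? 0)%nat then []
        else map (add_root k)
          (filter (fun q => k <=? length q)%nat (forests_of_type B n' (dec_at k tau))))
        (seq 0 B)
  end.

Lemma fdegs_add_root k q : (k <= length q)%nat -> fdegs (add_root k q) = k :: fdegs q.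
Proof.
  intros Hk. unfold add_root. unfold fdegs at 1. cbn [flat_map]. rewrite degs_Node.
  rewrite length_firstn, Nat.min_l by assumption. cbn [app]. f_equal.
  unfold fdegs. rewrite <- flat_map_app, firstn_skipn. reflexivity.
Qed.

Lemma in_forests_of_type_S B n tau f : In f (forests_of_type B (S n) tau) <->
  exists k q, (k < B)%nat /\ tau k <> 0%nat /\ (k <= length q)%nat /\
    In q (forests_of_type B n (dec_at k tau)) /\ f = add_root k q.
Proof.
  cbn [forests_of_type]. rewrite in_flat_map. split.
  - intros (k & Hk & H). apply in_seq in Hk. destruct (Nat.eqb_spec (tau k) 0); [destruct H|].
    apply in_map_iff in H as (q & <- & H). apply filter_In in H as [H Hl].
    apply Nat.leb_le in Hl. exists k, q. repeat split; auto; lia.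
  - intros (k & q & Hk & Ht & Hl & Hq & ->). exists k. split; [apply in_seq; lia|].
    destruct (Nat.eqb_spec (tau k) 0); [contradiction|]. apply in_map.
    apply filter_In. split; [assumption|]. now apply Nat.leb_le.
Qed.

Lemma NoDup_forests_of_type B n tau : NoDup (forests_of_type B n tau).
Proof.
  revert tau. induction n as [|n IH]; intros tau; [repeat constructor; simpl; tauto|].
  cbn [forests_of_type]. apply NoDup_flat_map_intro; [apply seq_NoDup| |].
  - intros k _. destruct (tau k =? 0)%nat; [constructor|].
    apply NoDup_map_intro; [now apply NoDup_filter|].
    intros q q' _ _ E. unfold add_root in E. injection E as E1 E2.
    rewrite <- (firstn_skipn k q), <- (firstn_skipn k q'). congruence.
  - intros k k' x _ _ H H'.
    destruct (tau k =? 0)%nat; [destruct H|]. destruct (tau k' =? 0)%nat; [destruct H'|].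
    apply in_map_iff in H as (q & <- & H). apply in_map_iff in H' as (q' & E & H').
    apply filter_In in H as [_ H]. apply filter_In in H' as [_ H'].
    apply Nat.leb_le in H, H'. unfold add_root in E. injection E as E _.
    apply (f_equal (@length tree)) in E. rewrite !length_firstn in E. lia.
Qed.

Section Types.

Variable B : nat.

Definition is_type (n : nat) (tau : nat -> nat) : Prop :=
  (forall i, (B <= i)%nat -> tau i = 0%nat) /\
  lsum (fun i => INR (tau i)) (seq 0 B) = INR n.

Lemma is_type_dec_at n tau k : is_type (S n) tau -> (k < B)%nat -> tau k <> 0%nat ->
  is_type n (dec_at k tau).
Proof.
  intros [Hs Hn] Hk Ht. split.
  - intros i Hi. rewrite dec_at_neq by lia. auto.
  - rewrite (lsum_upd _ (fun i => INR (dec_at k tau i)) _ k 1) in Hn.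
    + rewrite S_INR in Hn. lra.
    + apply seq_NoDup.
    + apply in_seq; lia.
    + rewrite dec_at_eq. destruct (tau k); [contradiction|]. rewrite S_INR. simpl pred. ring.
    + intros i Hi. now rewrite dec_at_neq.
Qed.

Lemma cnt_forests_of_type n tau f i : is_type n tau ->
  In f (forests_of_type B n tau) -> cnt (fdegs f) i = tau i.
Proof.
  revert tau f i. induction n as [|n IH]; intros tau f i Ht Hf.
  - destruct Hf as [<-|[]]. simpl. destruct Ht as [Hs Hn].
    destruct (Nat.le_gt_cases B i) as [Hi|Hi]; [symmetry; auto|].
    assert (INR (tau i) <= 0) as H.
    { change 0 with (INR 0). rewrite <- Hn.
      apply (lsum_ge_term (fun i => INR (tau i))); [apply in_seq; lia|].
      intros; apply pos_INR. }
    change 0 with (INR 0) in H. apply INR_le in H. lia.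
  - apply in_forests_of_type_S in Hf as (k & q & Hk & Htk & Hl & Hq & ->).
    rewrite fdegs_add_root by assumption.
    apply (IH _ _ i) in Hq; [|now apply is_type_dec_at].
    destruct (Nat.eq_dec k i) as [->|Hki].
    + rewrite count_occ_cons_eq, Hq, dec_at_eq by reflexivity. lia.
    + rewrite count_occ_cons_neq, Hq, dec_at_neq by congruence. reflexivity.
Qed.

Lemma length_forests_of_type n tau f : is_type n tau ->
  In f (forests_of_type B n tau) ->
  INR (length f) + lsum (fun i => INR i * INR (tau i)) (seq 0 B) = INR n.
Proof.
  intros Ht Hf.
  assert (Hc : forall i, cnt (fdegs f) i = tau i) by (intros; eapply cnt_forests_of_type; eauto).
  assert (Hlt : forall k, In k (fdegs f) -> (k < B)%nat).
  { intros k Hk. apply (count_occ_In Nat.eq_dec) in Hk. rewrite Hc in Hk.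
    destruct (Nat.le_gt_cases B k) as [H|H]; [|assumption].
    rewrite (proj1 Ht k H) in Hk. lia. }
  pose proof (f_equal INR (sum_fdegs f)) as E.
  rewrite <- length_fdegs, plus_INR, INR_list_sum, INR_length in E.
  rewrite (lsum_cnt INR _ B Hlt), (INR_length (fdegs f)), (lsum_cnt _ _ B Hlt) in E.
  rewrite INR_length.
  rewrite (lsum_ext_in (fun k => 1 * _) (fun i => INR (tau i))) in E
    by (intros; rewrite Hc; ring).
  rewrite (lsum_ext_in (fun k => INR k * _) (fun i => INR i * INR (tau i))) in E
    by (intros; rewrite Hc; ring).
  destruct Ht as [_ <-]. exact E.
Qed.

(* The exact number of forests of type [tau] with [j] roots and [n] vertices is
   [j / n * n! / prod (tau i)!]; the recurrence is checked termwise. *)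
Lemma forests_of_type_count n tau j : is_type (S n) tau ->
  lsum (fun i => INR i * INR (tau i)) (seq 0 B) + INR j = INR (S n) ->
  INR j * INR (fact n) <=
  INR (length (forests_of_type B (S n) tau))
    * lprod (fun i => INR (fact (tau i))) (seq 0 B).
Proof.
  revert tau j. induction n as [n IH] using (well_founded_induction lt_wf).
  intros tau j Ht Hj.
  assert (HP : forall tau, 1 <= lprod (fun i => INR (fact (tau i))) (seq 0 B)).
  { intros tau'. rewrite <- (pow1 (length (seq 0 B))), <- lprod_const.
    apply lprod_le_in. intros i _. split; [lra|].
    apply (le_INR 1). apply lt_O_fact. }
  destruct j as [|j].
  { simpl INR at 1. rewrite Rmult_0_l. apply Rmult_le_pos; [apply pos_INR|].
    specialize (HP tau). lra. }
  (* The bound expected when the first root has k children: S j roots turn into j + k. For a single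
     vertex the induction has no earlier case, and 1 - k is at most 1 for k = 0 and at most 0
     otherwise. *)
  set (X := fun k => match n with
                     | O => 1 - INR k
                     | S n' => (INR j + INR k) * INR (fact n') end).
  assert (HX : lsum (fun k => INR (tau k) * X k) (seq 0 B) = INR (S j) * INR (fact n)).
  { destruct Ht as [_ Hn]. unfold X. destruct n as [|n'].
    - rewrite (lsum_ext_in _ (fun k => INR (tau k) + -1 * (INR k * INR (tau k))))
        by (intros; ring).
      rewrite lsum_plus, lsum_scal, Hn. simpl fact. simpl INR in *. lra.
    - rewrite (lsum_ext_in _ (fun k => INR (fact n') *
        (INR j * INR (tau k) + INR k * INR (tau k)))) by (intros; ring).
      rewrite lsum_scal, lsum_plus, lsum_scal, Hn.
      change (fact (S n')) with (S n' * fact n')%nat. rewrite mult_INR.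
      rewrite !S_INR in *. replace (lsum (fun i => INR i * INR (tau i)) (seq 0 B))
        with (INR n' + 1 + 1 - (INR j + 1)) by lra. ring. }
  rewrite <- HX, (INR_length (forests_of_type _ _ _)). cbn [forests_of_type].
  rewrite lsum_flat_map, <- lsum_scal_r. apply lsum_le_in. intros k Hk.
  apply in_seq in Hk. rewrite <- INR_length.
  destruct (Nat.eqb_spec (tau k) 0) as [E|E].
  { rewrite E. simpl. lra. }
  assert (Ht' := is_type_dec_at n tau k Ht ltac:(lia) E).
  rewrite (lprod_upd _ (fun i => INR (fact (dec_at k tau i))) _ k (INR (tau k))).
  2: apply seq_NoDup.
  2: apply in_seq; lia.
  2:{ rewrite dec_at_eq. destruct (tau k) as [|m]; [contradiction|].
      rewrite <- mult_INR. reflexivity. }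
  2:{ intros i Hi. now rewrite dec_at_neq. }
  rewrite length_map.
  set (F := filter _ _). set (P := lprod _ _).
  replace (INR (length F) * (INR (tau k) * P)) with (INR (tau k) * (INR (length F) * P)) by ring.
  apply Rmult_le_compat_l; [apply pos_INR|].
  specialize (HP (dec_at k tau)). fold P in HP.
  destruct n as [|n'].
  - unfold X. destruct k as [|k].
    + simpl. unfold F. simpl. lra.
    + rewrite S_INR. pose proof (pos_INR k). pose proof (pos_INR (length F)). nra.
  - assert (Hj' : lsum (fun i => INR i * INR (dec_at k tau i)) (seq 0 B) + INR (j + k)
                  = INR (S n')).
    { rewrite (lsum_upd _ (fun i => INR i * INR (dec_at k tau i)) _ k (INR k)) in Hj.
      - rewrite plus_INR. rewrite !S_INR in *. lra.
      - apply seq_NoDup.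
      - apply in_seq; lia.
      - rewrite dec_at_eq. destruct (tau k); [contradiction|]. rewrite S_INR. simpl pred. ring.
      - intros i Hi. now rewrite dec_at_neq. }
    (* The type determines the number of roots, here j + k >= k, so the filter discards nothing. *)
    assert (EF : F = forests_of_type B (S n') (dec_at k tau)).
    { unfold F. apply forallb_filter_id. apply forallb_forall. intros q Hq.
      apply Nat.leb_le. apply length_forests_of_type in Hq; [|assumption].
      assert (INR (length q) = INR (j + k)) as Hl by lra. apply INR_eq in Hl. lia. }
    rewrite EF. unfold X. rewrite <- plus_INR. apply IH; auto.
Qed.

End Types.

(** * Stirling bounds and the probability of a degree type *)

(** The induction step is (1 + 1/m)^m <= e. *)
Lemma fact_exp_ge n : INR n ^ n <= INR (fact n) * exp (INR n).
Proof.
  induction n as [|n IH]; [simpl; rewrite exp_0; lra|].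
  destruct n as [|n]; [simpl; pose proof (exp_ineq1_le 1); lra|].
  set (m := S n) in *. assert (Hm : 0 < INR m) by (apply lt_0_INR; unfold m; lia).
  change (fact (S m)) with (S m * fact m)%nat. rewrite mult_INR, S_INR, exp_plus.
  assert ((INR m + 1) ^ m <= INR m ^ m * exp 1).
  { transitivity ((INR m * exp (/ INR m)) ^ m).
    - apply pow_incr. split; [lra|]. pose proof (exp_ineq1_le (/ INR m)) as H.
      apply (Rmult_le_compat_l (INR m)) in H; [|lra].
      rewrite Rmult_plus_distr_l, Rinv_r in H by lra. lra.
    - rewrite Rpow_mult_distr, exp_pow, Rinv_r by lra. lra. }
  rewrite <- tech_pow_Rmult. pose proof (exp_pos 1).
  transitivity ((INR m + 1) * (INR m ^ m * exp 1)).
  - apply Rmult_le_compat_l; lra.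
  - replace ((INR m + 1) * INR (fact m) * (exp (INR m) * exp 1))
      with ((INR m + 1) * (INR (fact m) * exp (INR m) * exp 1)) by ring.
    apply Rmult_le_compat_l; [lra|]. apply Rmult_le_compat_r; lra.
Qed.

(** The induction step is (1 + 1/m)^(m+1) >= e. *)
Lemma fact_exp_le n : INR (fact (S n)) * exp (INR (S n)) <= exp 1 * INR (S n) * INR (S n) ^ (S n).
Proof.
  induction n as [|n IH]; [simpl; lra|].
  set (m := S n) in *. assert (Hm : 0 < INR m) by (apply lt_0_INR; unfold m; lia).
  change (fact (S m)) with (S m * fact m)%nat. rewrite mult_INR, S_INR, exp_plus.
  assert (exp 1 * (INR m * INR m ^ m) <= (INR m + 1) * (INR m + 1) ^ m).
  { change (exp 1 * INR m ^ S m <= (INR m + 1) ^ S m).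
    transitivity (exp 1 * ((INR m + 1) * exp (- / (INR m + 1))) ^ S m).
    - apply Rmult_le_compat_l; [left; apply exp_pos|]. apply pow_incr. split; [lra|].
      pose proof (exp_ineq1_le (- / (INR m + 1))) as H.
      apply (Rmult_le_compat_l (INR m + 1)) in H; [|lra].
      rewrite Rmult_plus_distr_l, <- Ropp_mult_distr_r, Rinv_r in H by lra. lra.
    - rewrite Rpow_mult_distr, exp_pow, S_INR.
      replace ((INR m + 1) * - / (INR m + 1)) with (- (1)) by (field; lra).
      rewrite (Rmult_comm (_ ^ _)), <- Rmult_assoc, <- exp_plus.
      replace (1 + - (1)) with 0 by ring. rewrite exp_0. lra. }
  pose proof (exp_pos 1). rewrite <- (tech_pow_Rmult (INR m + 1) m).
  transitivity ((INR m + 1) * exp 1 * (exp 1 * INR m * INR m ^ m)).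
  - replace ((INR m + 1) * INR (fact m) * (exp (INR m) * exp 1))
      with ((INR m + 1) * exp 1 * (INR (fact m) * exp (INR m))) by ring.
    apply Rmult_le_compat_l; [nra|assumption].
  - replace (exp 1 * (INR m + 1) * ((INR m + 1) * (INR m + 1) ^ m))
      with ((INR m + 1) * exp 1 * ((INR m + 1) * (INR m + 1) ^ m)) by ring.
    apply Rmult_le_compat_l; [nra|]. lra.
Qed.

Definition same_type (t t' : tree) : bool :=
  if excluded_middle_informative (Permutation (degs t) (degs t')) then true else false.

Lemma same_typeP t t' : same_type t t' = true <-> Permutation (degs t) (degs t').
Proof.
  unfold same_type. destruct (excluded_middle_informative _); split; auto; discriminate.
Qed.

Lemma degs_lt t k : In k (degs t) -> (k < tsize t)%nat.
Proof.
  rewrite <- sum_degs. generalize (degs t). induction l as [|a l IH]; intros [].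
  - subst. simpl. lia.
  - specialize (IH H). change (list_sum (a :: l)) with (a + list_sum l)%nat. lia.
Qed.

Lemma degs_is_type t : is_type (tsize t) (tsize t) (fun k => cnt (degs t) k).
Proof.
  split.
  - intros i Hi. apply count_occ_not_In. intros H. apply degs_lt in H. lia.
  - rewrite <- length_degs at 2. rewrite INR_length, (lsum_cnt _ _ _ (degs_lt t)).
    apply lsum_ext_in; intros; ring.
Qed.

(** The forest count with one root: a type whose degrees sum to n - 1 consists of single trees. *)
Lemma same_type_count t :
  INR (fact (pred (tsize t))) <=
  INR (length (filter (same_type t) (trees_of_size (tsize t))))
    * lprod (fun k => INR (fact (cnt (degs t) k))) (seq 0 (tsize t)).
Proof.
  set (tau := fun k => cnt (degs t) k).
  pose proof (degs_is_type t) as Ht. fold tau in Ht.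
  pose proof (degs_lt t) as Hlt. pose proof (sum_degs t) as Hsum.
  destruct (tsize t) as [|m] eqn:En; [discriminate|]. simpl pred.
  assert (Hj : lsum (fun i => INR i * INR (tau i)) (seq 0 (S m)) + INR 1 = INR (S m)).
  { rewrite <- (f_equal INR Hsum), (S_INR (list_sum (degs t))), INR_list_sum.
    rewrite (lsum_cnt INR _ _ Hlt). reflexivity. }
  pose proof (forests_of_type_count _ m tau 1 Ht Hj) as H.
  simpl INR at 1 in H. rewrite Rmult_1_l in H. eapply Rle_trans; [apply H|].
  apply Rmult_le_compat_r.
  { apply lprod_nonneg. intros; apply pos_INR. }
  apply le_INR. rewrite <- (length_map (fun t => [t]) (filter _ _)).
  apply NoDup_incl_length; [apply NoDup_forests_of_type|].
  intros f Hf. pose proof (length_forests_of_type _ _ _ f Ht Hf) as Hl.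
  assert (INR (length f) = INR 1) as Hl1 by lra. apply INR_eq in Hl1.
  destruct f as [|t' [|]]; try discriminate. apply (in_map (fun t => [t])).
  assert (Hp : Permutation (degs t) (degs t')).
  { apply (Permutation_count_occ Nat.eq_dec). intros k.
    rewrite <- (app_nil_r (degs t')).
    symmetry. exact (cnt_forests_of_type _ _ _ _ k Ht Hf). }
  apply filter_In. split; [|now apply same_typeP].
  apply in_trees_of_size. rewrite <- En, <- !length_degs.
  symmetry. now apply Permutation_length.
Qed.

Definition emp (t : tree) (k : nat) : R := INR (cnt (degs t) k) / INR (tsize t).

Definition ndeg (t : tree) : nat :=
  length (filter (fun k => negb (cnt (degs t) k =? 0)%nat) (seq 0 (tsize t))).

Lemma lprod_filter {A} (p : A -> bool) (a : R) l :
  lprod (fun k => if p k then a else 1) l = a ^ length (filter p l).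
Proof.
  induction l as [|k l IH]; [reflexivity|]. rewrite lprod_cons, IH. simpl.
  destruct (p k); simpl; ring.
Qed.

(** The method of types: the class has [emp t]-probability at least (n-1)! n^(-n) times the product
    of tau_k^(tau_k) / tau_k!. Stirling bounds the first part below by exp(-n) / n and each factor
    with tau_k > 0 by exp(tau_k) / (e n); the exponentials cancel. *)
Lemma emp_type_prob_ge t :
  / INR (tsize t) * (/ (exp 1 * INR (tsize t))) ^ ndeg t <=
  INR (length (filter (same_type t) (trees_of_size (tsize t)))) * weight (emp t) t.
Proof.
  pose proof (same_type_count t) as Hc.
  set (N := INR (length _)) in *. pose proof (tsize_pos t) as Hpos.
  set (n := tsize t) in *. assert (Hn : 0 < INR n) by (apply lt_0_INR; lia).
  set (tau := fun k => cnt (degs t) k) in *.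
  assert (Hw : forall c, lprod c (degs t) = lprod (fun k => c k ^ tau k) (seq 0 n))
    by (intros; apply lprod_cnt, degs_lt).
  set (d := / (exp 1 * INR n)).
  assert (Hd : 0 < d) by (apply Rinv_0_lt_compat, Rmult_lt_0_compat; [apply exp_pos|lra]).
  set (r := fun k => / INR (fact (tau k)) * INR (tau k) ^ tau k).
  assert (Hf : forall k, 0 < INR (fact (tau k))) by (intros; apply lt_0_INR, lt_O_fact).
  assert (Hr : exp (INR n) * d ^ ndeg t <= lprod r (seq 0 n)).
  { unfold ndeg. fold n. rewrite <- lprod_filter.
    destruct (degs_is_type t) as [_ Hs]. fold n in Hs. rewrite <- Hs, <- lprod_exp, <- lprod_mult.
    apply lprod_le_in. intros k Hk. fold (tau k). pose proof (exp_pos (INR (tau k))).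
    (* A degree that does not occur contributes 1 and costs nothing, so the exponent is [ndeg t]. *)
    destruct (Nat.eqb_spec (tau k) 0) as [E|E]; simpl negb; cbv iota.
    - split; [lra|]. unfold r. rewrite E. simpl. rewrite exp_0. lra.
    - split; [nra|]. unfold r. apply (Rmult_le_reg_l (INR (fact (tau k)))); [auto|].
      rewrite <- (Rmult_assoc _ (/ _)), Rinv_r, Rmult_1_l by (specialize (Hf k); lra).
      assert (Hle : (tau k <= n)%nat)
        by (unfold tau, n; rewrite <- length_degs; apply count_occ_bound).
      destruct (tau k) as [|m] eqn:Em; [contradiction|].
      pose proof (fact_exp_le m) as H1. apply le_INR in Hle.
      rewrite <- Rmult_assoc. apply (Rmult_le_reg_r (/ d)); [now apply Rinv_0_lt_compat|].
      rewrite Rmult_assoc, Rinv_r, Rmult_1_r by lra. eapply Rle_trans; [apply H1|].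
      unfold d. rewrite Rinv_inv, Rmult_comm. apply Rmult_le_compat_l; [apply pow_le, pos_INR|].
      apply Rmult_le_compat_l; [left; apply exp_pos|assumption]. }
  assert (Hwt : weight (emp t) t * lprod (fun k => / INR (fact (tau k))) (seq 0 n)
                = (/ INR n) ^ n * lprod r (seq 0 n)).
  { rewrite weight_degs, Hw.
    transitivity (lprod (fun _ => / INR n) (degs t) * lprod r (seq 0 n)).
    2:{ now rewrite lprod_const, length_degs. }
    rewrite Hw, <- !lprod_mult. apply lprod_ext_in. intros k _.
    unfold emp, r, Rdiv. fold n (tau k). rewrite Rpow_mult_distr. ring. }
  set (P := lprod (fun k => INR (fact (cnt (degs t) k))) (seq 0 n)) in *.
  set (Q := lprod (fun k => / INR (fact (tau k))) (seq 0 n)) in *.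
  assert (HPQ : P * Q = 1).
  { unfold P, Q. rewrite <- lprod_mult, (lprod_ext_in _ (fun _ => 1)).
    - now rewrite lprod_const, pow1.
    - intros k _. apply Rinv_r, Rgt_not_eq, Hf. }
  assert (HP : 0 < P) by (apply lprod_pos; intros; apply Hf).
  replace (N * weight (emp t) t) with (N * P * (weight (emp t) t * Q))
    by (replace (N * P * (weight (emp t) t * Q)) with (N * weight (emp t) t * (P * Q)) by ring;
        rewrite HPQ; ring).
  rewrite Hwt.
  assert (Hnn : 0 < INR n ^ n) by (apply pow_lt; lra).
  transitivity (INR (fact (pred n)) * ((/ INR n) ^ n * (exp (INR n) * d ^ ndeg t))).
  - pose proof (fact_exp_ge n) as Hge.
    assert (Efact : INR (fact n) = INR n * INR (fact (pred n))).
    { destruct n as [|m]; [lia|]. rewrite <- mult_INR. reflexivity. }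
    rewrite Efact in Hge. rewrite pow_inv.
    replace (INR (fact (pred n)) * (/ INR n ^ n * (exp (INR n) * d ^ ndeg t)))
      with (/ INR n * (/ INR n ^ n * (INR n * INR (fact (pred n)) * exp (INR n))) * d ^ ndeg t)
      by (field; lra).
    apply Rmult_le_compat_r; [apply pow_le; lra|].
    rewrite <- (Rmult_1_r (/ INR n)) at 1.
    apply Rmult_le_compat_l; [left; now apply Rinv_0_lt_compat|].
    apply (Rmult_le_reg_l (INR n ^ n)); [assumption|].
    rewrite <- Rmult_assoc, Rinv_r, Rmult_1_l by lra. lra.
  - apply Rmult_le_compat.
    + apply pos_INR.
    + repeat apply Rmult_le_pos; try (apply pow_le; lra).
      * apply pow_le. left; now apply Rinv_0_lt_compat.
      * left; apply exp_pos.
    + assumption.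
    + apply Rmult_le_compat_l; [|assumption].
      apply pow_le. left; now apply Rinv_0_lt_compat.
Qed.

(** D distinct integers, all at least a, sum to at least a D + D (D - 1) / 2. *)
Lemma filter_seq_sum (p : nat -> bool) a m :
  let l := filter p (seq a m) in
  (length l * length l + 2 * a * length l <= 2 * list_sum l + length l)%nat.
Proof.
  cbv zeta. revert a. induction m as [|m IH]; intros a; [simpl; lia|].
  cbn [seq filter]. specialize (IH (S a)). set (l := filter p (seq (S a) m)) in *.
  destruct (p a); [|nia]. cbn [length].
  change (list_sum (a :: l)) with (a + list_sum l)%nat. nia.
Qed.

(** Distinct degrees sum to less than the number of vertices, which forces only O(sqrt n) of
    them. *)
Lemma ndeg_sq t : (ndeg t * ndeg t <= 2 * tsize t + ndeg t)%nat.
Proof.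
  unfold ndeg. set (p := fun k => _). set (l := filter p (seq 0 (tsize t))).
  pose proof (filter_seq_sum p 0 (tsize t)) as H. cbv zeta in H. fold l in H.
  assert (list_sum l <= tsize t)%nat; [|lia].
  apply INR_le. rewrite INR_list_sum.
  transitivity (lsum INR (degs t)).
  - rewrite (lsum_cnt _ _ _ (degs_lt t)).
    transitivity (lsum (fun k => INR k * INR (cnt (degs t) k)) l).
    + apply lsum_le_in. intros k Hk. unfold l in Hk. apply filter_In in Hk as [_ Hk].
      unfold p in Hk. destruct (Nat.eqb_spec (cnt (degs t) k) 0) as [|E]; [discriminate|].
      assert (1 <= INR (cnt (degs t) k)) by (apply (le_INR 1); lia).
      pose proof (pos_INR k). nra.
    + apply lsum_incl.
      * apply NoDup_filter, seq_NoDup.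
      * intros k Hk. now apply filter_In in Hk.
      * intros; apply Rmult_le_pos; apply pos_INR.
  - rewrite <- INR_list_sum. apply le_INR. pose proof (sum_degs t). lia.
Qed.

(** * Height and width of the conditioned tree *)

Lemma same_type_refl t : same_type t t = true.
Proof. now apply same_typeP. Qed.

Lemma same_type_sym t t' : same_type t t' = same_type t' t.
Proof.
  apply Bool.eq_true_iff_eq. rewrite !same_typeP. split; apply Permutation_sym.
Qed.

Lemma same_type_congr s t t' : same_type s t = true -> same_type s t' = same_type t t'.
Proof.
  intros H. apply Bool.eq_true_iff_eq. apply same_typeP in H. rewrite !same_typeP. split; intros H'.
  - now rewrite <- H.
  - now rewrite H.
Qed.

Lemma weight_same_type mu t t' : same_type t t' = true -> weight mu t = weight mu t'.
Proof. intros H. apply same_typeP in H. rewrite !weight_degs. now apply lprod_perm. Qed.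

Definition ind (b : bool) : R := if b then 1 else 0.

Lemma INR_length_filter {A} (p : A -> bool) l :
  INR (length (filter p l)) = lsum (fun a => ind (p a)) l.
Proof.
  induction l as [|a l IH]; [reflexivity|]. rewrite lsum_cons. simpl filter.
  destruct (p a); cbn [length ind]; rewrite ?S_INR, IH; lra.
Qed.

(* Weights are constant on types, so a bound on the proportion of [S] within each
   type passes to the conditioned measure. *)
Lemma type_average mu (L : list tree) (S : tree -> bool) rho :
  (forall k, 0 <= mu k) -> 0 <= rho ->
  (forall t, In t L -> S t = true ->
    lsum (fun t' => ind (S t') * ind (same_type t t')) L
      <= rho * INR (length (filter (same_type t) L))) ->
  lsum (fun t => if S t then weight mu t else 0) L <= rho * lsum (weight mu) L.
Proof.
  intros Hmu Hrho HS. set (N := fun t => INR (length (filter (same_type t) L))).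
  assert (HN : forall t, In t L -> 0 < N t).
  { intros t Ht. apply lt_0_INR. destruct (filter (same_type t) L) eqn:E; [|simpl; lia].
    assert (In t []) as []. rewrite <- E. apply filter_In. split; [assumption|].
    apply same_type_refl. }
  assert (HNs : forall t t', same_type t t' = true -> N t = N t').
  { intros t t' H. unfold N. f_equal. f_equal. apply filter_ext. intros s.
    now apply same_type_congr. }
  (* The weight of each tree is spread evenly over its class; exchanging the sums then collects the
     share received by each [t']. *)
  rewrite (lsum_ext_in _ (fun t => lsum (fun t' =>
    ind (S t) * (weight mu t * / N t) * ind (same_type t t')) L)).
  2:{ intros t Ht. rewrite lsum_scal, <- INR_length_filter. fold (N t).
      specialize (HN t Ht). destruct (S t); cbn [ind]; field; lra. }
  rewrite lsum_exchange, <- lsum_scal. apply lsum_le_in. intros t' Ht'.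
  rewrite (lsum_ext_in _ (fun t => weight mu t' * / N t' *
    (ind (S t) * ind (same_type t' t)))).
  2:{ intros t Ht. rewrite (same_type_sym t').
      destruct (same_type t t') eqn:E; cbn [ind]; [|ring].
      rewrite (weight_same_type mu t t' E), (HNs t t' E). ring. }
  rewrite lsum_scal. pose proof (HN t' Ht') as Hpos. pose proof (weight_ge0 mu t' Hmu).
  assert (Hle : lsum (fun t => ind (S t) * ind (same_type t' t)) L <= rho * N t').
  { destruct (classic (exists s, In s L /\ S s = true /\ same_type s t' = true))
      as [(s & Hs & HSs & Hst)|Hno].
    - specialize (HS s Hs HSs). fold (N s) in HS. rewrite (HNs s t' Hst) in HS.
      rewrite (lsum_ext_in _ (fun t => ind (S t) * ind (same_type s t))); [assumption|].
      intros t _. now rewrite (same_type_congr s t' t Hst).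
    - rewrite (lsum_ext_in _ (fun _ => 0)); [rewrite lsum_const; nra|].
      intros t Ht. destruct (S t) eqn:E1; cbn [ind]; [|ring].
      destruct (same_type t' t) eqn:E2; cbn [ind]; [|ring].
      exfalso. apply Hno. exists t. rewrite same_type_sym. auto. }
  apply (Rmult_le_compat_l (weight mu t' * / N t')) in Hle.
  - eapply Rle_trans; [apply Hle|]. right. field. lra.
  - apply Rmult_le_pos; [assumption|]. left; now apply Rinv_0_lt_compat.
Qed.

Lemma emp_ge0 t k : 0 <= emp t k.
Proof.
  apply Rmult_le_pos; [apply pos_INR|]. left. apply Rinv_0_lt_compat, lt_0_INR.
  pose proof (tsize_pos t); lia.
Qed.

Lemma lsum_emp c t B : (tsize t <= B)%nat ->
  lsum (fun k => emp t k * c k) (seq 0 B) = lsum c (degs t) / INR (tsize t).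
Proof.
  intros HB. rewrite (lsum_cnt c (degs t) B).
  - unfold Rdiv. rewrite <- lsum_scal_r. apply lsum_ext_in. intros; unfold emp, Rdiv; ring.
  - intros k Hk. apply degs_lt in Hk. lia.
Qed.

Lemma emp_sum_le t B : lsum (emp t) (seq 0 B) <= 1.
Proof.
  eapply Rle_trans; [apply (lsum_seq_mono _ B (B + tsize t) (emp_ge0 t)); lia|].
  rewrite (lsum_ext_in _ (fun k => emp t k * 1)) by (intros; ring).
  rewrite lsum_emp by lia. rewrite <- INR_length, length_degs.
  right. field. apply not_0_INR. pose proof (tsize_pos t). lia.
Qed.

(** Translates the lower bound on [capdeg] into the hypothesis of the Laplace bound for the law
    [emp t]. *)
Lemma emp_cap_sum t K :
  lsum (fun k => emp t k * INR (cap K k)) (seq 0 (S K)) = capdeg K t / INR (tsize t).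
Proof.
  unfold capdeg. rewrite <- (lsum_emp _ t (S K + tsize t)) by lia.
  rewrite seq_app, lsum_app, (lsum_ext_in _ (fun _ => 0) (seq (0 + S K) _)).
  - rewrite lsum_const. ring.
  - intros k Hk. apply in_seq in Hk. unfold cap. destruct (Nat.leb_spec k K); [lia|].
    simpl; ring.
Qed.

(** All trees of the class have the same weight p under [emp t]. The short ones have total weight at
    most the short-tree bound, the whole class at least the type bound; in the quotient p
    cancels. *)
Lemma short_proportion_le t K eps lam r h :
  (1 - eps) * INR (tsize t) <= capdeg K t ->
  0 <= lam -> lam * (INR K * INR K) <= eps -> r = 1 - 3 * eps -> 0 <= r <= 1 ->
  let n := tsize t in
  lsum (fun t' => ind (height t' <? h)%nat * ind (same_type t t')) (trees_of_size n)
    <= exp (- (eps * lam * r ^ h * INR n)) * INR n * (exp 1 * INR n) ^ ndeg t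
       * INR (length (filter (same_type t) (trees_of_size n))).
Proof.
  intros Hcap Hlam Hlk Hr Hr1 n.
  assert (Hn : 0 < INR n) by (apply lt_0_INR; pose proof (tsize_pos t); unfold n; lia).
  pose proof (emp_type_prob_ge t) as Hlow. fold n in Hlow.
  set (N := INR (length _)) in *. set (p := weight (emp t) t) in *.
  set (A := lsum (fun t' => _) _).
  set (E := exp (- (eps * lam * r ^ h * INR n))).
  assert (HA : A * p <= E).
  { eapply Rle_trans; [|apply (short_trees_exp_small (emp t) K eps lam r h n); auto].
    - unfold A. rewrite <- lsum_scal_r. apply lsum_le_in. intros t' _.
      pose proof (weight_ge0 (emp t) t' (emp_ge0 t)).
      destruct (height t' <? h)%nat; cbn [ind]; [|lra].
      destruct (same_type t t') eqn:Es; cbn [ind]; [|lra].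
      unfold p. rewrite (weight_same_type _ _ _ Es). lra.
    - apply emp_ge0.
    - apply emp_sum_le.
    - rewrite emp_cap_sum. fold n. apply (Rmult_le_reg_r (INR n)); [assumption|].
      unfold Rdiv. rewrite Rmult_assoc, Rinv_l by lra. fold n in Hcap. lra. }
  set (q := exp 1 * INR n) in *.
  assert (Hq : 0 < q) by (apply Rmult_lt_0_compat; [apply exp_pos|assumption]).
  assert (HQ : 0 < q ^ ndeg t) by now apply pow_lt.
  set (Q := q ^ ndeg t) in *.
  assert (Hlow' : 1 <= INR n * Q * N * p).
  { rewrite pow_inv in Hlow. fold Q in Hlow.
    apply (Rmult_le_compat_l (INR n * Q)) in Hlow; [|nra].
    replace (INR n * Q * (/ INR n * / Q)) with 1 in Hlow by (field; lra). lra. }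
  assert (HN : 0 <= N) by apply pos_INR.
  assert (Hp : 0 < p).
  { assert (0 <= p) by (apply weight_ge0, emp_ge0).
    destruct (Req_dec p 0) as [Ep|]; [|lra]. rewrite Ep in Hlow'. lra. }
  assert (HE : 0 < E) by apply exp_pos.
  apply (Rmult_le_reg_r p); [assumption|].
  eapply Rle_trans; [apply HA|].
  replace (E * INR n * Q * N * p) with (E * (INR n * Q * N * p)) by ring. nra.
Qed.

Lemma ln_ge0 x : 1 <= x -> 0 <= ln x.
Proof.
  intros [H| <-]; [|rewrite ln_1; lra]. left. rewrite <- ln_1. apply ln_increasing; lra.
Qed.

Lemma nat_above x : 0 <= x -> exists h, x < INR h <= x + 1.
Proof.
  intros Hx. destruct (archimed x) as [H1 H2]. exists (Z.to_nat (up x)).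
  rewrite INR_IZR_INZ, Z2Nat.id; [lra|]. apply le_IZR. lra.
Qed.

(* Writing n = y^8, the cost of fixing the type is exp (O(y^5)), the gain
   exp (- c y^6). *)
Lemma stretched_exp_beats_types c eps : 0 < c -> 0 < eps ->
  exists N, forall n D x, (N <= n)%nat -> (1 <= n)%nat -> (D * D <= 2 * n + D)%nat ->
    c * exp (- (ln (INR n) / 4)) * INR n <= x ->
    exp (- x) * INR n * (exp 1 * INR n) ^ D <= eps.
Proof.
  intros Hc He. set (l := Rmax 1 (- ln eps)).
  (* With w = y^4, L = ln n <= 8 y and D <= 3 w, the costs are D (1 + L) <= 27 y w and L <= 8 y w,
     in total 35 y w; [l] accounts for ln eps. *)
  destruct (exists_nat_ge (((l + 35) / c) ^ 8)) as [N HN]. exists (S N).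
  intros n D x Hn Hn1 HD Hx.
  assert (HnR : 1 <= INR n) by (apply (le_INR 1); assumption).
  set (L := ln (INR n)) in *.
  assert (HL : 0 <= L) by now apply ln_ge0.
  assert (EL : INR n = exp L) by (unfold L; rewrite exp_ln; lra).
  set (y := exp (L / 8)).
  assert (Hy8 : y ^ 8 = INR n) by (unfold y; rewrite exp_pow, EL; f_equal; simpl; field).
  assert (Hy1 : 1 <= y) by (unfold y; rewrite <- exp_0; apply exp_le_compat; lra).
  assert (Hly : L <= 8 * y) by (pose proof (exp_ineq1_le (L / 8)); fold y in H; lra).
  assert (Hl1 : 1 <= l) by apply Rmax_l.
  assert (Hle : - ln eps <= l) by apply Rmax_r.
  assert (Hlc : 0 < (l + 35) / c) by (apply Rdiv_lt_0_compat; lra).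
  assert (Hyl : l + 35 <= c * y).
  { apply Rnot_lt_le. intros Hlt.
    assert (y < (l + 35) / c).
    { apply (Rmult_lt_reg_l c); [assumption|].
      replace (c * ((l + 35) / c)) with (l + 35) by (field; lra). assumption. }
    assert (y ^ 8 <= ((l + 35) / c) ^ 8) by (apply pow_incr; lra).
    apply lt_INR in Hn. lra. }
  set (w := y * y * y * y).
  assert (Hw : 1 <= w) by (unfold w; assert (1 <= y * y) by nra; nra).
  assert (Hnw : INR n = w * w) by (rewrite <- Hy8; unfold w; ring).
  assert (HDw : INR D <= 3 * w).
  { apply Rnot_lt_le. intros Hlt. apply le_INR in HD.
    rewrite plus_INR, !mult_INR in HD. simpl (INR 2) in HD. nra. }
  assert (Hx6 : c * (y * (y * w)) <= x).
  { eapply Rle_trans; [|apply Hx]. rewrite Rmult_assoc. apply Rmult_le_compat_l; [lra|].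
    right. rewrite EL, <- exp_plus. unfold w, y. rewrite <- !exp_plus. f_equal. field. }
  rewrite EL, <- !exp_plus, exp_pow, <- exp_plus, <- (exp_ln eps He).
  apply exp_le_compat.
  assert (INR D * (1 + L) <= 3 * w * (1 + 8 * y)).
  { apply Rmult_le_compat; try lra. apply pos_INR. }
  assert (Hyw : y * w * (l + 35) <= c * (y * (y * w))).
  { replace (c * (y * (y * w))) with (y * w * (c * y)) by ring.
    apply Rmult_le_compat_l; [nra|assumption]. }
  assert (1 <= y * w) by nra. assert (w <= y * w) by nra. assert (y <= y * w) by nra.
  assert (l <= y * w * l) by nra. lra.
Qed.

Lemma n_exp_small c eps : 0 < c -> 0 < eps ->
  exists N, forall n, (N <= n)%nat -> INR n * exp (- (c * INR n)) < eps.
Proof.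
  intros Hc He. destruct (exists_nat_ge (4 / (c * c * eps))) as [N HN]. exists (S N).
  intros n Hn. assert (Hlt : INR N < INR n) by (apply lt_INR; lia).
  assert (Hn0 : 0 < INR n) by (pose proof (pos_INR N); lra).
  assert (Hcc : 0 < c * c * eps) by (repeat apply Rmult_lt_0_compat; assumption).
  assert (H4 : 4 < c * c * eps * INR n).
  { replace 4 with (c * c * eps * (4 / (c * c * eps))) by (field; split; lra).
    apply Rmult_lt_compat_l; lra. }
  (* Square exp(u / 2) >= u / 2. *)
  assert (Hex : c * INR n * (c * INR n) / 4 <= exp (c * INR n)).
  { replace (c * INR n) with (c * INR n / 2 + c * INR n / 2) at 3 by field.
    rewrite exp_plus. pose proof (exp_ineq1_le (c * INR n / 2)).
    assert (0 < c * INR n) by nra.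
    replace (c * INR n * (c * INR n) / 4) with (c * INR n / 2 * (c * INR n / 2)) by field.
    apply Rmult_le_compat; lra. }
  apply (Rmult_lt_reg_r (exp (c * INR n))); [apply exp_pos|].
  rewrite Rmult_assoc, <- exp_plus. replace (- (c * INR n) + c * INR n) with 0 by ring.
  rewrite exp_0, Rmult_1_r. eapply Rlt_le_trans; [|apply Rmult_le_compat_l; [lra|apply Hex]].
  replace (eps * (c * INR n * (c * INR n) / 4)) with (INR n * (c * c * eps * INR n / 4)) by field.
  nra.
Qed.

(** Half of the exponential rate is spent on the conditioning, the other half survives. *)
Lemma exp_div_prob_le mu c n x : 0 < prob_size mu n ->
  exp (- (INR n * (c / 2))) <= prob_size mu n -> 0 <= x ->
  x * exp (- (c * INR n)) / prob_size mu n <= x * exp (- (c / 2 * INR n)).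
Proof.
  intros Hp Hlow Hx. apply (Rmult_le_reg_r (prob_size mu n)); [assumption|].
  unfold Rdiv at 1. rewrite Rmult_assoc, Rinv_l, Rmult_1_r by lra.
  rewrite (Rmult_assoc x). apply Rmult_le_compat_l; [assumption|].
  replace (- (c * INR n)) with (- (c / 2 * INR n) + - (INR n * (c / 2))) by field.
  rewrite exp_plus. apply Rmult_le_compat_l; [left; apply exp_pos|assumption].
Qed.

Lemma fold_max_in l : fold_right Nat.max 0%nat l = 0%nat \/ In (fold_right Nat.max 0%nat l) l.
Proof.
  induction l as [|a l IH]; [now left|]. cbn [fold_right].
  destruct (Nat.max_spec a (fold_right Nat.max 0%nat l)) as [[H ->]|[H ->]].
  - right. right. destruct IH as [E|]; [lia|assumption].
  - right. now left.
Qed.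

Lemma width_attained t : (0 < width t)%nat ->
  exists k, (k < tsize t)%nat /\ width t = gen k t.
Proof.
  intros H. unfold width in *.
  destruct (fold_max_in (map (fun k => gen k t) (seq 0 (tsize t)))) as [E|Hin]; [lia|].
  apply in_map_iff in Hin as (k & Ek & Hk). apply in_seq in Hk. exists k. split; [lia|].
  now rewrite Ek.
Qed.

(** Every finite tree has a leaf, reached here along the leftmost branch. *)
Lemma weight_no_leaf mu t : mu 0%nat = 0 -> weight mu t = 0.
Proof.
  intros H. induction t as [|c f IH] using leftmost_ind; rewrite weight_Node.
  - cbn [length]. rewrite H. ring.
  - rewrite lprod_cons, IH. ring.
Qed.

Lemma height_conditioned_tree mu M eps : critical_offspring mu -> 0 < mu 0%nat ->
  0 < M -> 0 < eps ->
  exists N, forall n, (N <= n)%nat -> 0 < prob_size mu n ->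
    Pcond mu n (fun t => if Rle_dec (INR (height t)) (M * ln (INR n))
                         then true else false) < eps.
Proof.
  intros Hcrit H0 HM Heps. pose proof Hcrit as (Hmu & _).
  (* Chosen so that r^(M ln n) = n^(-1/4); [e] is then fixed by r = 1 - 3 e, and [K] and [lam]
     follow from [e]. *)
  set (r := exp (- (/ (4 * M)))).
  assert (HM4 : 0 < / (4 * M)) by (apply Rinv_0_lt_compat; lra).
  assert (Hr : 0 < r < 1).
  { split; [apply exp_pos|]. unfold r. rewrite <- exp_0. apply exp_increasing. lra. }
  set (e := (1 - r) / 3). assert (He : 0 < e) by (unfold e; lra).
  destruct (small_capdeg_exp_small mu e Hcrit He) as (K & c & HK & Hc & Hbad).
  assert (HKR : 1 <= INR K) by (apply (le_INR 1); lia).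
  set (lam := e / (INR K * INR K)).
  assert (Hlam : 0 < lam) by (unfold lam; apply Rdiv_lt_0_compat; nra).
  assert (Hlk : lam * (INR K * INR K) = e) by (unfold lam; field; nra).
  destruct (prob_size_subexp mu (c / 2) Hcrit H0 ltac:(lra)) as [N1 HN1].
  destruct (n_exp_small (c / 2) (eps / 2) ltac:(lra) ltac:(lra)) as [N2 HN2].
  destruct (stretched_exp_beats_types (e * lam * r) (eps / 2)) as [N3 HN3].
  { apply Rmult_lt_0_compat; [nra|lra]. }
  { lra. }
  exists (1 + N1 + N2 + N3)%nat. intros n Hn Hp.
  assert (Hn1 : 1 <= INR n) by (apply (le_INR 1); lia).
  assert (HL : 0 <= ln (INR n)) by now apply ln_ge0.
  destruct (nat_above (M * ln (INR n))) as (h & Hh1 & Hh2); [nra|].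
  (* Short trees with enough truncated degree sum; the others are negligible by [Hbad]. Every tree
     at which [type_average] asks for a bound thus has an empirical law of truncated mean at least 1
     - e. *)
  set (S := fun t => ((height t <? h)%nat
    && if Rlt_dec (capdeg K t) ((1 - e) * INR n) then false else true)%bool).
  assert (Hsplit : lsum (fun t => if (if Rle_dec (INR (height t)) (M * ln (INR n))
      then true else false) then weight mu t else 0) (trees_of_size n)
    <= lsum (fun t => if S t then weight mu t else 0) (trees_of_size n)
     + lsum (fun t => if Rlt_dec (capdeg K t) ((1 - e) * INR n) then weight mu t else 0)
         (trees_of_size n)).
  { rewrite <- lsum_plus. apply lsum_le_in. intros t _. pose proof (weight_ge0 mu t Hmu).
    unfold S. destruct (Rlt_dec (capdeg K t) ((1 - e) * INR n)) as [Hb|Hb].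
    - rewrite Bool.andb_false_r. destruct (Rle_dec _ _); lra.
    - rewrite Bool.andb_true_r. destruct (Rle_dec _ _) as [Hle|Hgt].
      + assert (height t < h)%nat by (apply INR_lt; lra).
        destruct (Nat.ltb_spec (height t) h); [lra|lia].
      + destruct (height t <? h)%nat; lra. }
  assert (Hshort : lsum (fun t => if S t then weight mu t else 0) (trees_of_size n)
                   <= eps / 2 * prob_size mu n).
  { rewrite prob_size_lsum. apply type_average; auto; [lra|].
    intros t Ht HS. apply in_trees_of_size in Ht.
    assert (Hcap : (1 - e) * INR (tsize t) <= capdeg K t).
    { unfold S in HS. rewrite Ht. destruct (Rlt_dec _ _); [|lra].
      rewrite Bool.andb_false_r in HS. discriminate. }
    pose proof (short_proportion_le t K e lam r h Hcap ltac:(lra) ltac:(lra)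
      ltac:(unfold e; lra) ltac:(lra)) as H. cbv zeta in H. rewrite Ht in H.
    eapply Rle_trans; [|eapply Rle_trans; [apply H|]].
    - apply lsum_le_in. intros t' _. apply Rmult_le_compat_r.
      + destruct (same_type t t'); cbn [ind]; lra.
      + unfold S. destruct (height t' <? h)%nat; cbn [andb ind]; [|lra].
        destruct (Rlt_dec _ _); cbn [ind]; lra.
    - apply Rmult_le_compat_r; [apply pos_INR|]. apply HN3; try lia.
      + rewrite <- Ht. apply ndeg_sq.
      (* Since h <= M ln n + 1, r^h >= r n^(-1/4); the rounding of h is the source of the extra
         factor [r] in the constant given to [stretched_exp_beats_types]. *)
      + apply Rmult_le_compat_r; [lra|]. rewrite (Rmult_assoc (e * lam)).
        apply Rmult_le_compat_l; [nra|]. unfold r. rewrite exp_pow, <- exp_plus.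
        apply exp_le_compat.
        apply (Rmult_le_compat_r (/ (4 * M))) in Hh2; [|lra].
        replace ((M * ln (INR n) + 1) * / (4 * M)) with (ln (INR n) / 4 + / (4 * M)) in Hh2
          by (field; lra).
        lra. }
  specialize (Hbad n). specialize (HN1 n ltac:(lia) Hp). specialize (HN2 n ltac:(lia)).
  pose proof (exp_div_prob_le mu c n 1 Hp HN1 ltac:(lra)) as Hdiv.
  assert (Hsmall : exp (- (c * INR n)) / prob_size mu n < eps / 2).
  { rewrite !Rmult_1_l in Hdiv. eapply Rle_lt_trans; [apply Hdiv|].
    eapply Rle_lt_trans; [|apply HN2].
    pose proof (exp_pos (- (c / 2 * INR n))). nra. }
  unfold Pcond. fold (lsum (fun t => if (if Rle_dec (INR (height t)) (M * ln (INR n))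
      then true else false) then weight mu t else 0) (trees_of_size n)).
  apply Rle_lt_trans with ((eps / 2 * prob_size mu n + exp (- (c * INR n))) / prob_size mu n).
  - apply Rmult_le_compat_r; [left; now apply Rinv_0_lt_compat|]. lra.
  - unfold Rdiv in *. rewrite Rmult_plus_distr_r, Rmult_assoc, Rinv_r by lra. lra.
Qed.

Lemma width_conditioned_tree mu delta eps : critical_offspring mu -> 0 < mu 0%nat ->
  0 < delta -> 0 < eps ->
  exists N, forall n, (N <= n)%nat -> 0 < prob_size mu n ->
    Pcond mu n (fun t => if Rlt_dec (delta * INR n) (INR (width t))
                         then true else false) < eps.
Proof.
  intros Hcrit H0 Hd Heps. pose proof Hcrit as (Hmu & _).
  destruct (large_gen_exp_small mu delta Hcrit Hd) as (c & Hc & Hgen).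
  destruct (prob_size_subexp mu (c / 2) Hcrit H0 ltac:(lra)) as [N1 HN1].
  destruct (n_exp_small (c / 2) eps ltac:(lra) ltac:(lra)) as [N2 HN2].
  exists (N1 + N2)%nat. intros n Hn Hp.
  assert (Hw : lsum (fun t => if (if Rlt_dec (delta * INR n) (INR (width t))
      then true else false) then weight mu t else 0) (trees_of_size n)
    <= INR n * exp (- (c * INR n))).
  (* Union bound over the n possible generations; the factor n is harmless against exp(-cn). *)
  { transitivity (lsum (fun k => lsum (fun t => if Rlt_dec (delta * INR n) (INR (gen k t))
      then weight mu t else 0) (trees_of_size n)) (seq 0 n)).
    - rewrite lsum_exchange. apply lsum_le_in. intros t Ht. apply in_trees_of_size in Ht.
      pose proof (weight_ge0 mu t Hmu) as Hwt.
      assert (Hpos : forall k, 0 <= if Rlt_dec (delta * INR n) (INR (gen k t))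
        then weight mu t else 0) by (intros; destruct (Rlt_dec _ _); lra).
      destruct (Rlt_dec (delta * INR n) (INR (width t))) as [Hlt|_];
        [|apply lsum_nonneg; auto].
      destruct (width_attained t) as (k & Hk & Ek).
      { apply INR_lt. simpl INR at 1. pose proof (pos_INR n). nra. }
      eapply Rle_trans; [|apply (lsum_ge_term _ _ k); [apply in_seq; lia|auto]].
      cbv beta. rewrite <- Ek. destruct (Rlt_dec _ _); lra.
    - eapply Rle_trans; [apply lsum_le_in; intros; apply Hgen|].
      rewrite lsum_const, length_seq. lra. }
  unfold Pcond. fold (lsum (fun t => if (if Rlt_dec (delta * INR n) (INR (width t))
      then true else false) then weight mu t else 0) (trees_of_size n)).
  apply Rle_lt_trans with (INR n * exp (- (c * INR n)) / prob_size mu n).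
  - apply Rmult_le_compat_r; [left; now apply Rinv_0_lt_compat|assumption].
  - eapply Rle_lt_trans; [|apply (HN2 n ltac:(lia))].
    apply exp_div_prob_le; auto using pos_INR. apply HN1; [lia|assumption].
Qed.

Theorem theorem1 (mu : nat -> R) (Hmu : critical_offspring mu) :
  (* Height(T_n) / ln n -> +oo in probability *)
  (forall M : R, 0 < M -> forall eps : R, 0 < eps ->
     exists N : nat, forall n : nat, (N <= n)%nat -> 0 < prob_size mu n ->
       Pcond mu n (fun t => if Rle_dec (INR (height t)) (M * ln (INR n))
                            then true else false) < eps) /\
  (* Width(T_n) / n -> 0 in probability *)
  (forall delta : R, 0 < delta -> forall eps : R, 0 < eps ->
     exists N : nat, forall n : nat, (N <= n)%nat -> 0 < prob_size mu n ->
       Pcond mu n (fun t => if Rlt_dec (delta * INR n) (INR (width t))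
                            then true else false) < eps).
Proof.
  (* Without leaves no finite tree has positive weight, so no n is admissible and both claims are
     vacuous. *)
  destruct (Req_dec (mu 0%nat) 0) as [E|E].
  - assert (Hz : forall n, ~ 0 < prob_size mu n).
    { intros n. rewrite prob_size_lsum, (lsum_ext_in _ (fun _ => 0)).
      - rewrite lsum_const. lra.
      - intros t _. now apply weight_no_leaf. }
    split; intros; exists 0%nat; intros n _ Hp; now apply Hz in Hp.
  - assert (H0 : 0 < mu 0%nat) by (pose proof (proj1 Hmu 0%nat); lra).
    split; intros; [now apply height_conditioned_tree|now apply width_conditioned_tree].
Qed.
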